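(* Let $X,\Sigma,A,T,f_\lambda$ be as in the context. Suppose that $x'=A(t)x$, $t\in\mathbb R$, admits an exponential dichotomy with constants $D,\rho>0$, that there is $c\ge0$ such that $|f_\lambda(t,x)-f_\lambda(t,y)|\le c|x-y|$ for all $t\in\mathbb R$, $\lambda\in\Sigma$, $x,y\in X$, and that $\tilde q:=\frac{2cD}{\rho}<1$. Let $k\in\mathbb N$. Take $\epsilon>0$ and for each $\lambda\in\Sigma$ let $y_\lambda\colon\mathbb R\to X$ be a differentiable map satisfying $$|y_\lambda'(t)-A(t)y_\lambda(t)-f_\lambda(t,y_\lambda(t))|\le\epsilon\quad\text{for all }t\in\mathbb R.$$ Let $x_\lambda\colon\mathbb R\to X$ be the unique solution of $x'=A(t)x+f_\lambda(t,x)$, $t\in\mathbb R$, with $\sup_{t\in\mathbb R}|x_\lambda(t)-y_\lambda(t)|\le\frac{\tilde L}{1-\tilde q}$, where $\tilde L=\frac{2\epsilon D}{\rho}$. In addition, suppose there exists $C>0$ such that the following conditions hold: (1) for each $t\in\mathbb R$ the map $(\lambda,x)\mapsto f_\lambda(t,x)$ is $C^{k+1}$, and for all $2\le i\le k+1$, $0\le j\le i$ and $t\in\mathbb R$, $$\sup_{\lambda\in\Sigma}\sup_{x\in X}\left\|\frac{\partial^i}{\partial\lambda^{i-j}\partial x^j}f_\lambda(t,x)\right\|\le C;$$ (2) for each $t\in\mathbb R$ the maps $\lambda\mapsto y_\lambda(t)$ and $\lambda\mapsto y_\lambda'(t)$ are both $C^{k+1}$, and $$\left|\frac{\partial^i}{\partial\lambda^i}y_\lambda'(t)-A(t)\frac{\partial^i}{\partial\lambda^i}y_\lambda(t)-\frac{d^i}{d\lambda^i}f_\lambda(t,y_\lambda(t))\right|\le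 C$$ for all $1\le i\le k+1$, all $t\in\mathbb R$ and all $\lambda\in\Sigma$. Furthermore, for every $\lambda_0\in\Sigma$ there exist $M_{\lambda_0}>1$ and a neighborhood $\Sigma_0$ of $\lambda_0$ such that $$\max_{1\le i\le k+1}\sup_{t\in\mathbb R}\left\|\frac{\partial^i}{\partial\lambda^i}y_\lambda(t)\right\|\le M_{\lambda_0}\quad\text{for each }\lambda\in\Sigma_0.$$ Then $\lambda\mapsto x_\lambda(t)$ is $C^k$ on $\Sigma$ for each $t\in\mathbb R$.
   Context: $X=(X,|\cdot|)$ is an arbitrary Banach space; $\mathcal B(X)$ is the space of bounded linear operators on $X$ with operator norm $\|\cdot\|$. $\Sigma$ is an open subset of another Banach space. $A\colon\mathbb R\to\mathcal B(X)$ is continuous and $T(t,s)$, $t,s\in\mathbb R$, is the evolution family of $x'=A(t)x$ (so $x(t)=T(t,s)x(s)$ for every solution $x$). For each $\lambda\in\Sigma$, $f_\lambda\colon\mathbb R\times X\to X$ is continuous. The equation $x'=A(t)x$ admits an exponential dichotomy if there exist a family $P(t)$, $t\in\mathbb R$, of projections on $X$ and constants $D,\rho>0$ such that $T(t,s)P(s)=P(t)T(t,s)$ for all $t,s\in\mathbb R$ and $\|\mathcal G(t,s)\|\le De^{-\rho|t-s|}$ for all $t,s\in\mathbb R$, where $$\mathcal G(t,s)=\begin{cases}T(t,s)P(s)& t\ge s,\\ -T(t,s)(\mathrm{Id}-P(s))& t<s.\end{cases}$$ Under the dichotomy, Lipschitz and $\tilde q<1$ hypotheses, the solution $x_\lambda$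 described in the claim exists and is unique for each $\lambda\in\Sigma$. The prime denotes the derivative in $t$. The symbols $\frac{\partial^i}{\partial\lambda^{i-j}\partial x^j}$ denote partial Fréchet derivatives, and $\frac{d^i}{d\lambda^i}f_\lambda(t,y_\lambda(t))$ is the $i$-th (total) derivative of $\lambda\mapsto f_\lambda(t,y_\lambda(t))$; norms of derivatives are norms of the corresponding multilinear maps. *)

(* Defs.v *)
From HB Require Import structures.
From mathcomp Require Import all_boot all_order all_algebra.
From mathcomp Require Import all_classical all_reals all_analysis.
Import Order.TTheory GRing.Theory Num.Theory.
Import numFieldNormedType.Exports.

Set Implicit Arguments.
Unset Strict Implicit.
Unset Printing Implicit Defensive.

Local Open Scope classical_set_scope.
Local Open Scope ring_scope.

Section BoundedLinearMaps.
Context {R : realType}.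
Implicit Types E F G : normedModType R.

Definition blin_pred E F : {pred E -> F} :=
  mem [set f : E -> F | linear f /\ continuous f].

Record blin E F := Blin {
  blin_fun :> E -> F;
  blin_funP : blin_fun \in @blin_pred E F }.

HB.instance Definition _ E F := [isSub for @blin_fun E F].
HB.instance Definition _ E F := [Choice of blin E F by <:].

Lemma blin_predP E F (f : E -> F) :
  reflect (linear f /\ continuous f) (f \in @blin_pred E F).
Proof. by apply: (iffP idP); rewrite inE. Qed.

Lemma blin_continuous E F (f : blin E F) : continuous f.
Proof. by case/blin_predP: (blin_funP f). Qed.

Lemma blin_linear E F (f : blin E F) : linear f.
Proof. by case/blin_predP: (blin_funP f). Qed.

HB.instance Definition _ E F (f : blin E F) :=
  GRing.isLinear.Build R E F *:%R (blin_fun f) (blin_linear f).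

Fact blin_submod_closed E F : submod_closed (@blin_pred E F).
Proof.
split.
  apply/blin_predP; split; last exact: cst_continuous.
  by move=> a x y /=; rewrite scaler0 addr0.
move=> a f g /blin_predP[lf cf] /blin_predP[lg cg]; apply/blin_predP; split.
  move=> b x y; rewrite !fctE lf lg !scalerDr addrACA; congr (_ + _ + _).
  by rewrite !scalerA mulrC.
move=> x; apply: continuousD; last exact: cg.
by apply: continuousZl_tmp; exact: cf.
Qed.

HB.instance Definition _ E F :=
  GRing.SubChoice_isSubLmodule.Build R (E -> F) (@blin_pred E F) (blin E F)
    (GRing.submod_closed_semi (@blin_submod_closed E F)).

Lemma blinDE E F (f g : blin E F) x : (f + g) x = f x + g x.
Proof. by []. Qed.

Lemma blinZE E F (a : R) (f : blin E F) x : (a *: f) x = a *: f x.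
Proof. by []. Qed.

Lemma blin0E E F x : (0 : blin E F) x = 0.
Proof. by []. Qed.

Lemma blinBE E F (f g : blin E F) x : (f - g) x = f x - g x.
Proof. by []. Qed.

Lemma blin_ext E F (f g : blin E F) : f =1 g -> f = g.
Proof. by move=> fg; apply: val_inj; apply/funext. Qed.

Definition opnorm E F (f : blin E F) : R :=
  sup [set `|f x| | x in [set x : E | `|x| <= 1]].

Lemma blin_bound E F (f : blin E F) :
  exists2 M, 0 <= M & forall x, `|f x| <= M * `|x|.
Proof.
have /linear_boundedP : bounded_near f (nbhs (0 : E)).
  by apply: continuous_linear_bounded; exact: blin_continuous.
move=> [M [_ fM]]; exists (`|M| + 1); first by rewrite addr_ge0.
by apply: fM; rewrite (le_lt_trans (ler_norm _))// ltrDl.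
Qed.

Lemma opnorm_has_sup E F (f : blin E F) :
  has_sup [set `|f x| | x in [set x : E | `|x| <= 1]].
Proof.
split; first by exists `|f 0|, 0 => //=; rewrite normr0.
have [M M0 fM] := blin_bound f; exists M => _ [x /= x1 <-].
by rewrite (le_trans (fM x))// ler_piMr.
Qed.

Lemma ler_opnorm E F (f : blin E F) x : `|f x| <= opnorm f * `|x|.
Proof.
have [->|x0] := eqVneq x 0; first by rewrite linear0 !normr0 mulr0.
have nx : 0 < `|x| by rewrite normr_gt0.
rewrite -ler_pdivrMr// mulrC -[X in X * _]ger0_norm ?invr_ge0// -normrZ.
rewrite -linearZ; apply: ub_le_sup; first by have [] := opnorm_has_sup f.
by exists (`|x|^-1 *: x) => //=; rewrite normrZ normfV normr_id mulVf// gt_eqF.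
Qed.

Lemma opnorm_le E F (f : blin E F) M :
  0 <= M -> (forall x, `|f x| <= M * `|x|) -> opnorm f <= M.
Proof.
move=> M0 fM; apply: ge_sup; first by have [] := opnorm_has_sup f.
by move=> _ [x /= x1 <-]; rewrite (le_trans (fM x))// ler_piMr.
Qed.

Lemma opnorm_ge0 E F (f : blin E F) : 0 <= opnorm f.
Proof.
apply: (le_trans (normr_ge0 (f 0))); apply: ub_le_sup.
  by have [] := opnorm_has_sup f.
by exists 0 => //=; rewrite normr0.
Qed.

Fact ler_opnormD E F (f g : blin E F) : opnorm (f + g) <= opnorm f + opnorm g.
Proof.
apply: opnorm_le => [|x]; first by rewrite addr_ge0// opnorm_ge0.
by rewrite blinDE (le_trans (ler_normD _ _))// mulrDl lerD// ler_opnorm.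
Qed.

Fact opnormZ_le E F (a : R) (f : blin E F) : opnorm (a *: f) <= `|a| * opnorm f.
Proof.
apply: opnorm_le => [|x]; first by rewrite mulr_ge0// opnorm_ge0.
by rewrite blinZE normrZ -mulrA ler_wpM2l// ler_opnorm.
Qed.

Fact opnormZ E F (a : R) (f : blin E F) : opnorm (a *: f) = `|a| * opnorm f.
Proof.
apply/eqP; rewrite eq_le opnormZ_le/=.
have [->|a0] := eqVneq a 0; first by rewrite normr0 mul0r opnorm_ge0.
rewrite -ler_pdivlMl ?normr_gt0// -normfV.
by rewrite -[X in opnorm X <= _](scalerK a0) opnormZ_le.
Qed.

Fact opnorm_eq0 E F (f : blin E F) : opnorm f = 0 -> f = 0.
Proof.
move=> f0; apply: blin_ext => x; apply/eqP; rewrite blin0E -normr_le0.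
by rewrite (le_trans (ler_opnorm f x))// f0 mul0r.
Qed.

HB.instance Definition _ E F :=
  Lmodule_isNormed.Build R (blin E F)
    (@ler_opnormD E F) (@opnormZ E F) (@opnorm_eq0 E F).

Lemma blin_idP E : (@idfun E) \in @blin_pred E E.
Proof. by apply/blin_predP; split=> // x; exact: cvg_id. Qed.

Definition blin_id E : blin E E := Blin (blin_idP E).

Lemma blin_compP E F G (g : blin F G) (f : blin E F) :
  (g \o f) \in @blin_pred E G.
Proof.
apply/blin_predP; split; first by move=> a x y; rewrite /= !linearP.
by move=> x; apply: continuous_comp; exact: blin_continuous.
Qed.

Definition blin_comp E F G (g : blin F G) (f : blin E F) : blin E G :=
  Blin (blin_compP g f).

Lemma opnorm_comp E F G (g : blin F G) (f : blin E F) :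
  opnorm (blin_comp g f) <= opnorm g * opnorm f.
Proof.
apply: opnorm_le => [|x]; first by rewrite mulr_ge0// opnorm_ge0.
rewrite (le_trans (ler_opnorm g (f x)))// -mulrA ler_wpM2l ?opnorm_ge0//.
exact: ler_opnorm.
Qed.

Lemma blin_postP E F G (g : blin F G) :
  (@blin_comp E F G g) \in @blin_pred (blin E F) (blin E G).
Proof.
have lin : linear (@blin_comp E F G g).
  by move=> a u v; apply: blin_ext => x /=; rewrite linearP.
apply/blin_predP; split => //.
pose h : {linear blin E F -> blin E G} :=
  HB.pack (@blin_comp E F G g) (GRing.isLinear.Build _ _ _ _ _ lin).
apply: (@bounded_linear_continuous _ _ _ h); apply/linear_boundedP.
exists (opnorm g); split; first exact: num_real.
move=> M gM u; rewrite (le_trans (opnorm_comp g u))//.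
by apply: ler_wpM2r (ltW gM); exact: opnorm_ge0.
Qed.

Definition blin_post E F G (g : blin F G) : blin (blin E F) (blin E G) :=
  Blin (blin_postP E g).

End BoundedLinearMaps.

Section Frechet.
Context {R : realType}.
Implicit Types E F G : normedModType R.

(* The Frechet derivative as a bounded operator; 0 where ['d f x] is not
   continuous, hence only meaningful where f is differentiable. *)
Definition frechet E F (f : E -> F) (x : E) : blin E F :=
  insubd (0 : blin E F) ('d f x : E -> F).

(* n-linear maps in curried form, blin E (blin E (.. F)): the iterated operator
   norm of this space is the usual norm of a bounded multilinear map. *)
Fixpoint multilin E F (n : nat) : normedModType R :=
  match n with
  | 0 => F
  | n'.+1 => multilin E (blin E F) n'
  end.

Fixpoint iter_frechet E F (n : nat) (f : E -> F) : E -> multilin E F n :=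
  match n return E -> multilin E F n with
  | 0 => f
  | n'.+1 => iter_frechet n' (frechet f)
  end.

(* Application of g to the values of an n-linear map. *)
Fixpoint multilin_post E F G (n : nat) (g : blin F G) :
    multilin E F n -> multilin E G n :=
  match n return multilin E F n -> multilin E G n with
  | 0 => g
  | n'.+1 => multilin_post (n := n') (blin_post E g)
  end.

(* f is of class C^n on U; intended for open U, as differentiability and
   continuity are taken in E. *)
Fixpoint class_C E F (n : nat) (U : set E) (f : E -> F) : Prop :=
  match n with
  | 0 => forall x, U x -> {for x, continuous f}
  | n'.+1 => (forall x, U x -> differentiable f x) /\ class_C n' U (frechet f)
  end.

(* d^(m+n) f / dl^m dx^n, differentiating in x first. *)
Definition mixed_partial E F G (m n : nat) (f : E -> F -> G) (l : E) (x : F) :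
    multilin E (multilin F G n) m :=
  iter_frechet m (fun l' => iter_frechet n (f l') x) l.

End Frechet.

Section Dichotomy.
Context {R : realType} {X : completeNormedModType R}.

Definition is_solution (v : R -> X -> X) (x : R -> X) : Prop :=
  forall t : R, is_derive t 1 x (v t (x t)).

Definition evolution_family (A : R -> blin X X) (T : R -> R -> blin X X) : Prop :=
  (forall s v, T s s v = v /\ is_solution (fun t => A t) (fun t => T t s v)) /\
  (forall x, is_solution (fun t => A t) x -> forall t s, x t = T t s (x s)).

Definition green (T : R -> R -> blin X X) (P : R -> blin X X) (t s : R) :
    blin X X :=
  if s <= t then blin_comp (T t s) (P s)
  else - blin_comp (T t s) (blin_id X - P s).

Definition exponential_dichotomy (T : R -> R -> blin X X) (D rho : R) : Prop :=
  [/\ 0 < D, 0 < rho &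
    exists P : R -> blin X X,
      [/\ forall t, blin_comp (P t) (P t) = P t,
          forall t s, blin_comp (T t s) (P s) = blin_comp (P t) (T t s) &
          forall t s, `|green T P t s| <= D * expR (- rho * `|t - s|)]].

End Dichotomy.

(* Main.v *)
(** If z' = A z + h with z and h bounded, the mean value inequality applied to
    T(t,s)P(s)z(s) and to T(t,s)(Id - P(s))z(s) gives |z| <= (2D/rho) |h| in the
    sup norm. The difference z_l = x_l - y_l lies in the Banach space B of
    bounded functions and satisfies Gam (z_l, N(l, z_l)), where Gam is the graph
    of z |-> z' - A z and N(l, z) = f_l(., y_l + z) + A y_l - y_l'. The bounds on
    the derivatives of order up to k+1 make N a C^k map in the sup norm, and N is
    c-Lipschitz in z with (2D/rho) c < 1.

    By the a priori bound the difference quotients of z_l are Cauchy, hence z_l is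
    differentiable; its derivative U satisfies an equation of the same shape in
    the space of operators from Lam to B, with N'(l, U) = DN(l, z_l) (id, U) and
    the closure of Gam in place of Gam, so that the C^k regularity follows by
    induction on k. Neither the solvability of z' = A z + h nor any integral is
    needed, since x_l is given. *)
Require Import Defs.
From HB Require Import structures.
From mathcomp Require Import all_boot all_order all_algebra.
From mathcomp Require Import ring lra.
From mathcomp Require Import all_classical all_reals all_analysis.
Import Order.TTheory GRing.Theory Num.Theory.
Import numFieldNormedType.Exports.
Set Implicit Arguments.
Unset Strict Implicit.
Unset Printing Implicit Defensive.
Local Open Scope classical_set_scope.
Local Open Scope ring_scope.

(** * Frechet derivatives and mean value inequalities *)

(** The functions y_l need not be bounded in t, and neither need the first derivatives of f in l
    along them. Condition (2) controls exactly the residual f_l(t, y_l) - (y_l' - A y_l), whose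
    derivatives of orders 1 to k + 1 are bounded by [C] while the residual itself is bounded by
    [eps]. Therefore N(l, z) is split into the increment f_l(t, y_l + z) - f_l(t, y_l) and this
    residual. In the increment, first derivatives of f occur only in the direction of x, where c
    bounds them, or as differences, which second derivatives control. Condition (1) bounds
    derivatives taken in x before l; the symmetry of second derivatives brings every other order
    into this one.

    A family whose derivatives up to order n + 1 are bounded uniformly in t yields a superposition
    operator of class C^n only, since the top bound is spent on continuity in the sup norm. This
    accounts for k + 1 in the hypotheses and k in the conclusion. The 2 in 2D/rho comes from adding
    the stable and the unstable part, each at most D/rho times |h|. *)

Section FrechetDerivative.
Context {R : realType}.
Implicit Types E F G : normedModType R.

(** One predicate for differentiability and the value of the derivative, open to direct estimates;
    the non-strict bound makes h = 0 harmless. *)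
Definition has_frechet E F (f : E -> F) (x : E) (L : blin E F) :=
  forall e : R, 0 < e ->
    \forall h \near (0 : E), `|f (x + h) - f x - L h| <= e * `|h|.

Lemma frechetE E F (f : E -> F) x :
  differentiable f x -> frechet f x = 'd f x :> (E -> F).
Proof.
move=> df; rewrite /frechet.
have P : ('d f x : E -> F) \in @blin_pred R E F.
  by apply/blin_predP; split; [exact: linearP | exact: diff_continuous].
exact: (@insubdK _ _ (blin E F) 0 _ P).
Qed.

Lemma has_frechetP E F (f : E -> F) x (L : blin E F) :
  has_frechet f x L <-> differentiable f x /\ frechet f x = L.
Proof.
split=> [fL|[df <-]]; last first.
  move=> e e0; rewrite frechetE//.
  have /eqaddoP/(_ e e0) := diff_locally df; apply: filterS => h /=.
  rewrite -[X in `|X| <= _]/(f (h + x) - (f x + 'd f x h)) opprD addrA.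
  by rewrite (addrC h).
have o : f \o shift x = cst (f x) + (L : {linear E -> F}) +o_ 0 id.
  apply/eqaddoP => e e0; move: (fL e e0); apply: filterS => h /=.
  rewrite -[X in _ -> `|X| <= _]/(f (h + x) - (f x + L h)) opprD addrA.
  by rewrite (addrC h).
have := @diff_unique _ E F f L x (@blin_continuous _ _ _ L) o => dE.
have df : differentiable f x.
  by apply/diff_locallyP; rewrite dE; split=> //; exact: blin_continuous.
by split=> //; apply: blin_ext => v; rewrite frechetE// dE.
Qed.

End FrechetDerivative.

Section MeanValue.
Context {R : realType}.
Implicit Types V E F : normedModType R.

(** Continuous induction: the set of s with [P a s] contains a point beyond its supremum unless the
    supremum is [b]. The local hypothesis concerns only intervals that contain the base point [s],
    which is what an estimate at [s] provides. *)
Lemma segment_additive (P : R -> R -> Prop) (a b : R) : a <= b ->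
  (forall x y z, a <= x -> x <= y -> y <= z -> z <= b ->
    P x y -> P y z -> P x z) ->
  (forall s, a <= s -> s <= b -> exists2 d, 0 < d &
    forall x y, a <= x -> x <= s -> s <= y -> y <= b ->
      s - d < x -> y < s + d -> P x y) ->
  P a b.
Proof.
move=> ab Ptrans Ploc.
pose S := [set s | a <= s <= b /\ P a s].
have Sa : S a.
  have [d d0 Pd] := Ploc a (lexx a) ab.
  by split; rewrite ?lexx ?ab//; apply: Pd; rewrite // ?ltrDl// ltrBlDr ltrDl.
have Sub : ubound S b by move=> s [/andP[]].
have supS : has_sup S by split; [exists a|exists b].
have as0 : a <= sup S by apply: ub_le_sup => //; exists b.
have s0b : sup S <= b by apply: ge_sup => //; exists a.
have [d d0 Pd] := Ploc _ as0 s0b.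
have [s Ss ds] := sup_adherent d0 supS.
have ss0 : s <= sup S by apply: ub_le_sup => //; exists b.
case: (Ss) => /andP[als sb] Pas.
(* [s] and [y] lie on either side of the supremum and within [d] of it, so the local hypothesis
   joins them. *)
pose y := Num.min b (sup S + d / 2).
have s0y : sup S <= y by rewrite le_min s0b lerDl divr_ge0// ltW.
have yb : y <= b by rewrite ge_min lexx.
have Psy : P s y.
  apply: Pd => //; rewrite gt_min; apply/orP; right.
  by rewrite ltrD2l ltr_pdivrMr// ltr_pMr// ltr1n.
have Sy : S y.
  split; first by rewrite yb (le_trans as0).
  by apply: Ptrans Pas Psy => //; exact: le_trans s0y.
have : y <= sup S by apply: ub_le_sup => //; exists b.
rewrite /y ge_min => /orP[bs0|].
  by move: Sy => [_]; rewrite /y min_l// (le_trans bs0)// lerDl divr_ge0// ltW.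
by rewrite gerDl leNgt divr_gt0.
Qed.

(** Only the upper slopes of [phi] are bounded, because the map s -> [T t s (Q s (z s))] of
    [dichotomy_half] is known only through such slopes. Weakened by e (y - x), the inequality is
    additive on adjacent intervals, so [segment_additive] reduces it to a neighbourhood of each
    point. *)
Lemma mean_value_le V (phi : R -> V) (B b : R -> R) (x y : R) : x <= y ->
  (forall s, x <= s -> s <= y -> 0 <= b s) ->
  (forall s, x <= s -> s <= y -> is_derive s 1 B (b s)) ->
  (forall s e, x <= s -> s <= y -> 0 < e -> \forall r \near s,
    x <= r -> r <= y -> `|phi r - phi s| <= (b s + e) * `|r - s|) ->
  `|phi y - phi x| <= B y - B x.
Proof.
move=> xy b0 dB dphi.
suff H e : 0 < e -> `|phi y - phi x| <= B y - B x + e * (y - x).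
  apply/ler_addgt0Pr => e e0; rewrite (le_trans (H (e / (y - x + 1)) _))//.
    by rewrite divr_gt0// ltr_wpDl// subr_ge0.
  rewrite lerD2l -mulrA ler_piMr ?(ltW e0)//.
  have yx : 0 < y - x + 1 by rewrite ltr_wpDl// subr_ge0.
  by rewrite mulrC ler_pdivrMr// mul1r lerDl.
move=> e0; pose P r s := `|phi s - phi r| <= B s - B r + e * (s - r).
apply: (segment_additive (P := P)) => //.
  move=> r s t _ rs st _ Prs Pst; rewrite /P.
  rewrite -(subrKA (phi s)) (le_trans (ler_normD _ _))// (le_trans (lerD Pst Prs))//.
  by rewrite addrACA !subrKA -mulrDr subrKA.
move=> s xs sy.
(* One half of [e] pays for the slope of [phi], the other for the first-order expansion of [B]. *)
have e20 : 0 < e / 2 by rewrite divr_gt0.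
have near1 := dphi s _ xs sy e20.
have [Bd BE] := dB s xs sy.
have near2 : \forall r \near s, `|B r - B s - b s * (r - s)| <= e / 2 * `|r - s|.
  have /derivable_nbhs/eqaddoP/(_ _ e20) := Bd.
  rewrite [X in _ -> X](near_shift 0) subr0; apply: filterS => h /=.
  rewrite -[X in `|X| <= _ -> _]/(B (h *: 1 + s) - (B s + h *: 'D_1 B s)) BE.
  by rewrite /GRing.scale/= mulr1 addrK opprD addrA [h * b s]mulrC.
have /nbhs_ballP[d /= d0 Hd] : \forall r \near s, (x <= r -> r <= y ->
    `|phi r - phi s| <= (b s + e / 2) * `|r - s|) /\
    `|B r - B s - b s * (r - s)| <= e / 2 * `|r - s|.
  by near=> r; split; near: r.
exists d => // u v xu us sv vy du dv.
have ub : ball s d u.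
  by rewrite /ball/= ger0_norm ?subr_ge0// ltrBlDr addrC -ltrBlDr.
have vb : ball s d v.
  by rewrite /ball/= ler0_norm ?subr_le0// opprB ltrBlDl.
have {ub}[ + /ler_normlP[u3 u2]] := Hd _ ub => /(_ xu (le_trans us sy)) u1.
have {vb}[ + /ler_normlP[v3 v2]] := Hd _ vb => /(_ (le_trans xs sv) vy) v1.
have bs := b0 s xs sy.
rewrite /P -(subrKA (phi s)) (le_trans (ler_normD _ _))// [`|phi s - _|]distrC.
rewrite (le_trans (lerD v1 u1))//.
move: u2 u3 v2 v3; rewrite [`|v - s|]ger0_norm ?subr_ge0//.
rewrite [`|u - s|]ler0_norm ?subr_le0//.
by move=> *; lra.
Unshelve. all: by end_near. Qed.

Lemma near_scale0 E (v : E) (Q : E -> Prop) (s : R) :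
  (\forall h \near (0 : E), Q h) -> \forall r \near s, Q ((r - s) *: v).
Proof.
move=> Qh; have : (fun r => (r - s) *: v) @ s --> (0 : E).
  rewrite -(scale0r v) -(subrr s); apply: cvgZr_tmp; apply: cvgB => //.
  exact: cvg_cst.
exact.
Qed.

Lemma mean_value_frechet E F (phi : E -> F) (p v : E) (M : R) :
  (forall s, 0 <= s -> s <= 1 -> differentiable phi (p + s *: v)) ->
  (forall s, 0 <= s -> s <= 1 -> `|frechet phi (p + s *: v) v| <= M) ->
  `|phi (p + v) - phi p| <= M.
Proof.
move=> dphi hM.
have M0 : 0 <= M by apply: le_trans (hM 0 _ _).
have := @mean_value_le F (fun s => phi (p + s *: v)) (fun s => M * s) (cst M) 0 1 ler01.
rewrite scale1r scale0r addr0 mulr1 mulr0 subr0; apply => //.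
  move=> s _ _; rewrite -[X in is_derive _ _ _ X](mulr1 M).
  exact: (is_deriveZ (f:=id)).
move=> s e s0 s1 e0.
have e'0 : 0 < e / (`|v| + 1) by rewrite divr_gt0// ltr_wpDl.
have /has_frechetP/(_ _ e'0) := conj (dphi s s0 s1) (erefl (frechet phi (p + s *: v))).
move=> /(near_scale0 v s); apply: filterS => r H _ _.
have -> : p + r *: v = p + s *: v + (r - s) *: v.
  by rewrite -addrA -scalerDl subrKC.
have := ler_normD (phi (p + s *: v + (r - s) *: v) - phi (p + s *: v) -
   frechet phi (p + s *: v) ((r - s) *: v)) (frechet phi (p + s *: v) ((r - s) *: v)).
rewrite subrK => /le_trans; apply.
rewrite addrC mulrDl lerD//.
  by rewrite linearZ normrZ mulrC ler_wpM2r// hM.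
rewrite (le_trans H)// normrZ mulrCA [leRHS]mulrC ler_wpM2l//.
rewrite -mulrA ler_piMr ?(ltW e0)// mulrC ler_pdivrMr ?mul1r ?lerDl//.
Qed.

End MeanValue.

(** * Bounded bilinear products and the rules of differentiation *)

Section Calculus.
Context {R : realType}.
Implicit Types E F G H : normedModType R.

Definition bounded_lin E F (f : E -> F) :=
  linear f /\ exists M, forall x, `|f x| <= M * `|x|.

(** Total, with value 0 if [f] is not linear and bounded, so that operators can be written as
    formulas and boundedness is owed only when they are evaluated. *)
Definition mkblin E F (f : E -> F) : blin E F := insubd (0 : blin E F) f.

Lemma mkblinE E F (f : E -> F) : bounded_lin f -> mkblin f = f :> (E -> F).
Proof.
move=> [lf [M fM]].
pose h : {linear E -> F} := HB.pack f (GRing.isLinear.Build _ _ _ _ _ lf).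
have cf : continuous f.
  apply: (@bounded_linear_continuous _ _ _ h); apply/linear_boundedP.
  exists M; split; first exact: num_real.
  by move=> N MN x; rewrite (le_trans (fM x))// ler_wpM2r// ltW.
have P : f \in @blin_pred R E F by apply/blin_predP.
exact: (@insubdK _ _ (blin E F) 0 _ P).
Qed.

Lemma ler_blin E F (f : blin E F) x : `|f x| <= `|f| * `|x|.
Proof. exact: ler_opnorm. Qed.

Lemma blin_norm_le E F (f : blin E F) M :
  0 <= M -> (forall x, `|f x| <= M * `|x|) -> `|f| <= M.
Proof. exact: opnorm_le. Qed.

Definition bounded_bilin E F G (b : E -> F -> G) :=
  [/\ forall u, linear (b u), forall v, linear (b ^~ v) &
      exists2 M, 0 <= M & forall u v, `|b u v| <= M * `|u| * `|v|].

Lemma bounded_bilinD E F G (b : E -> F -> G) : bounded_bilin b ->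
  (forall u v, b u (- v) = - b u v) *
  (forall u v, b (- u) v = - b u v) *
  (forall u v w, b u (v + w) = b u v + b u w) *
  (forall u v w, b (u + v) w = b u w + b v w) *
  (forall a u v, b u (a *: v) = a *: b u v) *
  (forall a u v, b (a *: u) v = a *: b u v) *
  (forall u, b u 0 = 0) * (forall v, b 0 v = 0).
Proof.
move=> [lr ll _].
have Dr u v w : b u (v + w) = b u v + b u w.
  by have := lr u 1 v w; rewrite !scale1r.
have Dl u v w : b (u + v) w = b u w + b v w.
  by have := ll w 1 u v; rewrite !scale1r.
have r0 u : b u 0 = 0 by apply: (addIr (b u 0)); rewrite -Dr !add0r.
have l0 u : b 0 u = 0 by apply: (addIr (b 0 u)); rewrite -Dl !add0r.
have Zr a u v : b u (a *: v) = a *: b u v.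
  by have := lr u a v 0; rewrite !addr0 r0 addr0.
have Zl a u v : b (a *: u) v = a *: b u v.
  by have := ll v a u 0; rewrite !addr0 l0 addr0.
have Nr u v : b u (- v) = - b u v by rewrite -scaleN1r Zr scaleN1r.
have Nl u v : b (- u) v = - b u v by rewrite -scaleN1r Zl scaleN1r.
by do !split.
Qed.

Lemma blin_comp_bilin E F G :
  bounded_bilin (fun (g : blin F G) (f : blin E F) => blin_comp g f).
Proof.
split=> [g a u v|f a u v|].
- by apply: blin_ext => x /=; rewrite linearP.
- by apply: blin_ext.
- by exists 1 => // g f; rewrite mul1r; exact: opnorm_comp.
Qed.

Lemma bilin_left E F G H (b : F -> G -> H) (v : G) (L : blin E F) :
  bounded_bilin b -> bounded_lin (fun x => b (L x) v).
Proof.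
move=> bb; have [_ _ [M M0 bM]] := bb; split.
  by move=> a x y; rewrite linearP (bounded_bilinD bb) (bounded_bilinD bb).
exists (M * `|L| * `|v|) => x; rewrite (le_trans (bM _ _))//.
by rewrite [leRHS]mulrAC ler_wpM2r// -mulrA ler_wpM2l// ler_blin.
Qed.

Lemma bilin_right E F G H (b : F -> G -> H) (u : F) (L : blin E G) :
  bounded_bilin b -> bounded_lin (fun x => b u (L x)).
Proof.
move=> bb; have [_ _ [M M0 bM]] := bb; split.
  by move=> a x y; rewrite linearP (bounded_bilinD bb) (bounded_bilinD bb).
exists (M * `|u| * `|L|) => x; rewrite (le_trans (bM _ _))//.
by rewrite -[leRHS]mulrA ler_wpM2l ?mulr_ge0// ler_blin.
Qed.

(** The first summand of the product rule is again a bounded bilinear expression, in the derivative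
    of one factor and the other factor. Together with [bilin_lift_right] this closes the induction
    on the order in [unif_C_bilin]. *)
Lemma bilin_lift_left E F G H (b : F -> G -> H) : bounded_bilin b ->
  bounded_bilin (fun (L : blin E F) (v : G) => mkblin (fun x => b (L x) v)).
Proof.
move=> bb; have [_ _ [M M0 bM]] := bb.
have E1 v (L : blin E F) x : mkblin (fun x => b (L x) v) x = b (L x) v.
  by rewrite (mkblinE (bilin_left v L bb)).
split.
- move=> L a v w; apply: blin_ext => x.
  by rewrite blinDE blinZE !E1 !(bounded_bilinD bb).
- move=> v a L L'; apply: blin_ext => x.
  by rewrite blinDE blinZE !E1 blinDE blinZE !(bounded_bilinD bb).
exists M => // L v; apply: blin_norm_le; first by rewrite !mulr_ge0.
move=> x; rewrite E1 (le_trans (bM _ _))//.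
by rewrite [leRHS]mulrAC ler_wpM2r// -mulrA ler_wpM2l// ler_blin.
Qed.

Lemma bilin_lift_right E F G H (b : F -> G -> H) : bounded_bilin b ->
  bounded_bilin (fun (u : F) (L : blin E G) => mkblin (fun x => b u (L x))).
Proof.
move=> bb; have [_ _ [M M0 bM]] := bb.
have E1 u (L : blin E G) x : mkblin (fun x => b u (L x)) x = b u (L x).
  by rewrite (mkblinE (bilin_right u L bb)).
split.
- move=> u a L L'; apply: blin_ext => x.
  by rewrite blinDE blinZE !E1 blinDE blinZE !(bounded_bilinD bb).
- move=> L a u w; apply: blin_ext => x.
  by rewrite blinDE blinZE !E1 !(bounded_bilinD bb).
exists M => // u L; apply: blin_norm_le; first by rewrite !mulr_ge0.
move=> x; rewrite E1 (le_trans (bM _ _))//.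
by rewrite -[leRHS]mulrA ler_wpM2l ?mulr_ge0// ler_blin.
Qed.

Lemma near_addr0 E (P : E -> Prop) (x : E) :
  (\forall y \near x, P y) -> \forall h \near (0 : E), P (x + h).
Proof. by rewrite (near_shift 0) subr0; apply: filterS => h /=; rewrite addrC. Qed.

Lemma has_frechet_near_eq E F (f g : E -> F) x L :
  (\forall y \near x, f y = g y) -> has_frechet f x L -> has_frechet g x L.
Proof.
move=> fg fL e e0; have fgx : f x = g x := nbhs_singleton fg.
have {}fg : \forall h \near (0 : E), f (x + h) = g (x + h).
  exact: near_addr0 fg.
by near=> h; rewrite -fgx -(near fg h)//; near: h; exact: fL.
Unshelve. all: by end_near. Qed.

Lemma has_frechet_cst E F (a : F) (x : E) : has_frechet (cst a) x 0.
Proof.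
move=> e e0; near=> h.
by rewrite blin0E subr0 /= subrr normr0 mulr_ge0// ltW.
Unshelve. all: by end_near. Qed.

Lemma has_frechet_blin E F (L : blin E F) (x : E) : has_frechet L x L.
Proof.
move=> e e0; near=> h.
by rewrite linearD [L x + _]addrC addrK subrr normr0 mulr_ge0// ltW.
Unshelve. all: by end_near. Qed.

Lemma has_frechetD E F (f g : E -> F) x L L' :
  has_frechet f x L -> has_frechet g x L' -> has_frechet (f \+ g) x (L + L').
Proof.
move=> /has_frechetP[df <-] /has_frechetP[dg <-]; apply/has_frechetP.
have dfg := differentiableD df dg; split=> //.
apply: blin_ext => v.
have -> : frechet (f \+ g) x v = 'd (f \+ g) x v by rewrite (frechetE dfg).
have Ef : frechet f x v = 'd f x v by rewrite (frechetE df).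
have Eg : frechet g x v = 'd g x v by rewrite (frechetE dg).
by rewrite (diffD df dg); apply/esym; exact: (congr2 +%R Ef Eg).
Qed.

Lemma has_frechet_comp E F G (f : E -> F) (g : F -> G) x L L' :
  has_frechet f x L -> has_frechet g (f x) L' ->
  has_frechet (g \o f) x (blin_comp L' L).
Proof.
move=> /has_frechetP[df <-] /has_frechetP[dg <-]; apply/has_frechetP.
have dfg := differentiable_comp df dg; split=> //.
apply: blin_ext => v.
have -> : frechet (g \o f) x v = 'd (g \o f) x v by rewrite (frechetE dfg).
rewrite (diff_comp df dg) -[RHS]/(frechet g (f x) (frechet f x v)).
by rewrite (frechetE df) (frechetE dg).
Qed.

Lemma has_frechet_continuous E F (f : E -> F) x L :
  has_frechet f x L -> {for x, continuous f}.
Proof. by move=> /has_frechetP[/differentiable_continuous]. Qed.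

Lemma has_frechet_bilin E F G H (b : F -> G -> H) (f : E -> F) (g : E -> G) x L L' :
  bounded_bilin b -> has_frechet f x L -> has_frechet g x L' ->
  has_frechet (fun y => b (f y) (g y)) x
    (mkblin (fun v => b (L v) (g x)) + mkblin (fun v => b (f x) (L' v))).
Proof.
move=> bb fL gL e e0; have [_ _ [M M0 bM]] := bb.
(* The three error terms below add up to M K e1 |h|; the part 1 + |L| of [K] bounds |f (x + h) - f
   x| / |h| because [e1] is at most 1. *)
pose K := `|g x| + `|f x| + `|L| + 1.
have K0 : 1 <= K by rewrite lerDr !addr_ge0.
have Kp : 0 < K by exact: lt_le_trans K0.
pose e1 := Num.min 1 (e / ((M + 1) * K)).
have MK : 0 < (M + 1) * K by rewrite mulr_gt0// ltr_wpDl.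
have e10 : 0 < e1 by rewrite lt_min ltr01 divr_gt0.
have e11 : e1 <= 1 by rewrite ge_min lexx.
have e1e : M * K * e1 <= e.
  have : (M + 1) * K * e1 <= e.
    by rewrite mulrC -ler_pdivlMr// ge_min lexx orbT.
  by apply: le_trans; rewrite !ler_wpM2r// ?lerDl// ltW.
have gc : \forall h \near (0 : E), `|g (x + h) - g x| <= e1.
  have /cvgr_distC_le/(_ e1 e10) := has_frechet_continuous gL.
  exact: near_addr0.
have fe1 := fL e1 e10.
have ge1 := gL e1 e10.
near=> h.
rewrite blinDE (mkblinE (bilin_left (g x) L bb)) (mkblinE (bilin_right (f x) L' bb)).
have -> : b (f (x + h)) (g (x + h)) - b (f x) (g x) - (b (L h) (g x) + b (f x) (L' h))
  = b (f (x + h) - f x - L h) (g x) + b (f x) (g (x + h) - g x - L' h)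
    + b (f (x + h) - f x) (g (x + h) - g x).
  rewrite !(bounded_bilinD bb).
  rewrite !opprD !opprK !addrA.
  by rewrite [RHS](ACl (7*2*3*6*1*9*4*8*5*10))/= addrK addrK subrK.
have h1 : `|f (x + h) - f x - L h| <= e1 * `|h| by near: h.
have h2 : `|g (x + h) - g x - L' h| <= e1 * `|h| by near: h.
have h3 : `|g (x + h) - g x| <= e1 by near: h.
have h4 : `|f (x + h) - f x| <= (1 + `|L|) * `|h|.
  rewrite -[f _ - f x](subrK (L h)) (le_trans (ler_normD _ _))// mulrDl lerD//.
    by rewrite (le_trans h1)// ler_wpM2r.
  exact: ler_blin.
have b1 : `|b (f (x + h) - f x - L h) (g x)| <= M * (e1 * `|h|) * `|g x|.
  by rewrite (le_trans (bM _ _))// ler_wpM2r// ler_wpM2l.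
have b2 : `|b (f x) (g (x + h) - g x - L' h)| <= M * `|f x| * (e1 * `|h|).
  by rewrite (le_trans (bM _ _))// ler_wpM2l// mulr_ge0.
have b3 : `|b (f (x + h) - f x) (g (x + h) - g x)| <= M * ((1 + `|L|) * `|h|) * e1.
  rewrite (le_trans (bM _ _))// ler_pM// ?mulr_ge0//.
  by rewrite ler_wpM2l.
rewrite (le_trans (ler_normD _ _))// (le_trans (lerD (ler_normD _ _) b3))//.
rewrite (le_trans (lerD (lerD b1 b2) (lexx _)))//.
have : M * K * e1 * `|h| <= e * `|h| by rewrite ler_wpM2r.
apply: le_trans; rewrite le_eqVlt; apply/orP; left; apply/eqP; rewrite /K; ring.
Unshelve. all: by end_near. Qed.

End Calculus.

(** * Families of class C^n with uniform bounds *)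

Section UniformClass.
Context {R : realType}.
Implicit Types (E F G H : normedModType R) (I : Type).

(** The neighbourhood as well as the bound serves all indices [t] at once. *)
Definition loc_ubounded I E F (U : set E) (g : I -> E -> F) :=
  forall e0, U e0 -> exists M, \forall e \near e0, forall t, `|g t e| <= M.

(** Continuity is asked for each index separately; continuity uniform in the index is drawn from the
    bound on the next derivative. *)
Fixpoint unif_C I E F (n : nat) (U : set E) (g : I -> E -> F) : Prop :=
  loc_ubounded U g /\
  match n with
  | 0 => forall t x, U x -> {for x, continuous (g t)}
  | n'.+1 => (forall t x, U x -> differentiable (g t) x) /\
             unif_C n' U (fun t => frechet (g t))
  end.

(* The part of [unif_C] that does not bound the functions themselves. *)
Definition unif_dC I E F (n : nat) (U : set E) (g : I -> E -> F) : Prop :=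
  match n with
  | 0 => forall t x, U x -> {for x, continuous (g t)}
  | n'.+1 => (forall t x, U x -> differentiable (g t) x) /\
             unif_C n' U (fun t => frechet (g t))
  end.

Lemma unif_CE I E F n (U : set E) (g : I -> E -> F) :
  unif_C n U g <-> loc_ubounded U g /\ unif_dC n U g.
Proof. by case: n. Qed.

Lemma unif_CW I E F n (U : set E) (g : I -> E -> F) :
  unif_C n.+1 U g -> unif_C n U g.
Proof.
elim: n F g => [|n IH] F g [gb [gd gC]]; split => //.
  by move=> t x Ux; exact/differentiable_continuous/gd.
by split=> //; exact: IH.
Qed.

Lemma unif_dCW I E F n (U : set E) (g : I -> E -> F) :
  unif_dC n.+1 U g -> unif_dC n U g.
Proof.
case: n => [|n] [gd gC] /=.
  by move=> t x Ux; exact/differentiable_continuous/gd.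
by split=> //; exact: unif_CW.
Qed.

Lemma unif_C_class I E F n (U : set E) (g : I -> E -> F) t :
  unif_C n U g -> class_C n U (g t).
Proof.
elim: n F g => [|n IH] F g [_ /=]; first exact.
move=> [gd gC]; split; first exact: gd.
exact: (IH (blin E F) (fun t => frechet (g t))).
Qed.

Lemma continuous_loc_ubounded E F (U : set E) (f : E -> F) :
  (forall x, U x -> {for x, continuous f}) -> loc_ubounded U (fun _ : unit => f).
Proof.
move=> fc x Ux; exists (`|f x| + 1).
have /cvgr_distC_le/(_ 1 ltr01) := fc x Ux.
apply: filterS => e fe _.
by rewrite -[f e](subrK (f x)) addrC (le_trans (ler_normD _ _))// lerD.
Qed.

Lemma class_C_continuous E F n (U : set E) (f : E -> F) :
  class_C n U f -> forall x, U x -> {for x, continuous f}.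
Proof.
by case: n => //= n [fd _] x Ux; exact/differentiable_continuous/fd.
Qed.

(** Continuous derivatives are locally bounded, so [class_C] is [unif_C] over a one-point index set,
    and its rules are read off from those for families. *)
Lemma class_C_unif E F n (U : set E) (f : E -> F) :
  class_C n U f -> unif_C n U (fun _ : unit => f).
Proof.
elim: n F f => [|n IH] F f fC; split.
- exact: (continuous_loc_ubounded fC).
- by move=> _.
- exact/continuous_loc_ubounded/(class_C_continuous fC).
by case: fC => fd fC; split=> //; exact: IH.
Qed.

Lemma class_CW E F n (U : set E) (f : E -> F) :
  class_C n.+1 U f -> class_C n U f.
Proof. by move=> /class_C_unif/unif_CW/(unif_C_class tt). Qed.

Lemma frechet_near_eq E F (f g : E -> F) x :
  (\forall y \near x, f y = g y) -> differentiable f x ->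
  differentiable g x /\ frechet g x = frechet f x.
Proof.
move=> fg fd; apply/has_frechetP; apply: has_frechet_near_eq fg _.
exact/has_frechetP.
Qed.

Lemma unif_C_eq I E F n (U : set E) (g g' : I -> E -> F) : open U ->
  (forall t x, U x -> g t x = g' t x) -> unif_C n U g -> unif_C n U g'.
Proof.
move=> oU; have nU x : U x -> \forall y \near x, U y.
  by move=> Ux; exact: open_nbhs_nbhs.
elim: n F g g' => [|n IH] F g g' gg' /unif_CE[gb gC]; apply/unif_CE; split=> /=.
1,3: move=> e Ue; have [M gM] := gb e Ue; exists M;
  by apply: filterS2 gM (nU e Ue) => z gz Uz t; rewrite -gg'.
  move=> t x Ux; rewrite /prop_for/continuous_at -gg'//.
  apply: cvg_trans (gC t x Ux); apply: near_eq_cvg.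
  by apply: filterS (nU x Ux) => y Uy; rewrite gg'.
case: gC => gd gC.
have gg t x : U x -> differentiable (g' t) x /\ frechet (g' t) x = frechet (g t) x.
  move=> Ux; apply: frechet_near_eq; last exact: gd.
  by apply: filterS (nU x Ux) => y Uy; rewrite gg'.
split; first by move=> t x /(gg t)[].
by apply: (IH _ (fun t => frechet (g t))) gC => t x /(gg t)[_ ->].
Unshelve. all: by end_near. Qed.

Lemma unif_C0 I E F n (U : set E) : unif_C n U (fun (_ : I) (_ : E) => (0 : F)).
Proof.
have H F' : loc_ubounded U (fun (_ : I) (_ : E) => (0 : F')).
  by move=> e _; exists 0; near=> z => _; rewrite normr0.
have d F' x : differentiable (fun _ : E => 0 : F') x /\ frechet (fun _ : E => 0 : F') x = 0.
  by apply/has_frechetP; exact: has_frechet_cst.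
elim: n F => [|n IH] F; split => //.
  by move=> _ x _; exact: cst_continuous.
split; first by move=> _ x _; case: (d F x).
rewrite (_ : (fun _ => _) = fun (_ : I) (_ : E) => 0); first exact: IH.
by apply/funext => t; apply/funext => x; case: (d F x).
Unshelve. all: by end_near. Qed.

Lemma unif_C_cst I E F n (U : set E) (a : I -> F) (M : R) :
  (forall t, `|a t| <= M) -> unif_C n U (fun (t : I) (_ : E) => a t).
Proof.
move=> aM; apply/unif_CE; split.
  by move=> e _; exists M; near=> z => t.
case: n => [|n] /=.
  by move=> t x _; exact: cst_continuous.
have d t x : differentiable (fun _ : E => a t) x /\ frechet (fun _ : E => a t) x = 0.
  by apply/has_frechetP; exact: has_frechet_cst.
split; first by move=> t x _; case: (d t x).
rewrite (_ : (fun _ => _) = fun (_ : I) (_ : E) => 0); first exact: unif_C0.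
by apply/funext => t; apply/funext => x; case: (d t x).
Unshelve. all: by end_near. Qed.

Lemma near_norm_le1 E (x : E) : \forall e \near x, `|e| <= `|x| + 1.
Proof.
have /cvgr_distC_le/(_ 1 ltr01) : {for x, continuous (@idfun E)} by exact: cvg_id.
apply: filterS => e fe.
by rewrite -[e](subrK x) addrC (le_trans (ler_normD _ _))// lerD.
Qed.

Lemma unif_C_lin I E F n (U : set E) (L : I -> blin E F) (M : R) :
  (forall t, `|L t| <= M) -> unif_C n U (fun t : I => L t : E -> F).
Proof.
move=> LM; apply/unif_CE; split.
  move=> e _; exists (`|M| * (`|e| + 1)).
  near=> z => t; rewrite (le_trans (ler_blin _ _))// ler_pM//.
    by rewrite (le_trans (LM t))// ler_norm.
  by near: z; exact: near_norm_le1.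
case: n => [|n] /=.
  by move=> t x _; exact: blin_continuous.
have d t x : differentiable (L t) x /\ frechet (L t) x = L t.
  by apply/has_frechetP; exact: has_frechet_blin.
split; first by move=> t x _; case: (d t x).
rewrite (_ : (fun _ => _) = fun (t : I) (_ : E) => L t); first exact: unif_C_cst LM.
by apply/funext => t; apply/funext => x; case: (d t x).
Unshelve. all: by end_near. Qed.

Lemma unif_CD I E F n (U : set E) (f g : I -> E -> F) : open U ->
  unif_C n U f -> unif_C n U g -> unif_C n U (fun t x => f t x + g t x).
Proof.
move=> oU; elim: n F f g => [|n IH] F f g /unif_CE[fb fC] /unif_CE[gb gC];
  apply/unif_CE; split.
1,3: move=> e Ue; have [M fM] := fb e Ue; have [N gN] := gb e Ue;
  exists (M + N); near=> z => t; rewrite (le_trans (ler_normD _ _))// lerD//;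
  by move: t; near: z.
  by move=> t x Ux; apply: continuousD; [exact: fC | exact: gC].
case: fC gC => [fd fC] [gd gC].
have d t x : U x -> differentiable (fun x => f t x + g t x) x /\
    frechet (fun x => f t x + g t x) x = frechet (f t) x + frechet (g t) x.
  move=> Ux; apply/has_frechetP; apply: has_frechetD; apply/has_frechetP.
    by split=> //; exact: fd.
  by split=> //; exact: gd.
split; first by move=> t x /(d t)[].
by apply: unif_C_eq (IH _ _ _ fC gC) => // t x /(d t)[_ /esym].
Unshelve. all: by end_near. Qed.

Lemma continuous_bilin E F G H (b : F -> G -> H) (f : E -> F) (g : E -> G) x :
  bounded_bilin b -> {for x, continuous f} -> {for x, continuous g} ->
  {for x, continuous (fun y => b (f y) (g y))}.
Proof.
move=> bb fc gc; have [_ _ [M M0 bM]] := bb.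
apply/cvgrPdist_le => e e0.
pose K := (M + 1) * (`|f x| + `|g x| + 2).
have K0 : 0 < K by rewrite mulr_gt0// ltr_wpDl// addr_ge0.
have d0 : 0 < Num.min 1 (e / K) by rewrite lt_min ltr01 divr_gt0.
have dK : Num.min 1 (e / K) * K <= e.
  by rewrite -ler_pdivlMr// ge_min lexx orbT.
have d1 : Num.min 1 (e / K) <= 1 by rewrite ge_min lexx.
move: (Num.min _ _) d0 dK d1 => d d0 dK d1.
have /cvgr_dist_le/(_ d d0) fd := fc; have /cvgr_dist_le/(_ d d0) gd := gc.
near=> y.
have fy : `|f x - f y| <= d by near: y.
have gy : `|g x - g y| <= d by near: y.
have -> : b (f x) (g x) - b (f y) (g y) = b (f x - f y) (g y) + b (f x) (g x - g y).
  rewrite !(bounded_bilinD bb).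
  by rewrite !addrA [RHS](ACl (3*2*1*4))/= addrK.
have g1 : `|g y| <= `|g x| + 1.
  rewrite -[g y](subrK (g x)) addrC (le_trans (ler_normD _ _))// lerD//.
  by rewrite distrC (le_trans gy).
rewrite (le_trans (ler_normD _ _))// (le_trans (lerD (bM _ _) (bM _ _)))//.
apply: le_trans (_ : M * d * (`|g x| + 1) + M * `|f x| * d <= _).
  by rewrite lerD// ler_pM ?mulr_ge0// ler_wpM2l.
apply: le_trans dK.
have := normr_ge0 (f x); have := normr_ge0 (g x).
move: (`|f x|) (`|g x|) @K K0 => p q /= K0 q0 p0.
by rewrite -subr_ge0 [X in 0 <= X](_ : _ = d * (M + (p + q + 2))); [rewrite mulr_ge0 ?ltW// ltr_wpDl// ltr_wpDl// addr_ge0 | ring].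
Unshelve. all: by end_near. Qed.

Lemma unif_C_bilin I E F G H n (U : set E) (b : F -> G -> H)
    (f : I -> E -> F) (g : I -> E -> G) : open U -> bounded_bilin b ->
  unif_C n U f -> unif_C n U g -> unif_C n U (fun t x => b (f t x) (g t x)).
Proof.
move=> oU; elim: n F G H b f g => [|n IH] F G H b f g bb fnC gnC;
  move/unif_CE: (fnC) => [fb fC]; move/unif_CE: (gnC) => [gb gC];
  have [_ _ [K K0 bK]] := bb; apply/unif_CE; split.
1,3: move=> e Ue; have [M fM] := fb e Ue; have [N gN] := gb e Ue;
  exists (K * M * N); near=> z => t; rewrite (le_trans (bK _ _))//;
  rewrite ler_pM ?mulr_ge0// ?ler_wpM2l//; by move: t; near: z.
  by move=> t x Ux; apply: continuous_bilin => //; [exact: fC | exact: gC].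
case: fC gC => [fd fC] [gd gC].
have d t x : U x -> differentiable (fun x => b (f t x) (g t x)) x /\
    frechet (fun x => b (f t x) (g t x)) x =
    mkblin (fun v => b (frechet (f t) x v) (g t x)) +
    mkblin (fun v => b (f t x) (frechet (g t) x v)).
  move=> Ux; apply/has_frechetP; apply: has_frechet_bilin => //; apply/has_frechetP.
    by split=> //; exact: fd.
  by split=> //; exact: gd.
split; first by move=> t x /(d t)[].
apply: (@unif_C_eq _ _ _ _ U (fun t x => mkblin (fun v => b (frechet (f t) x v) (g t x)) +
    mkblin (fun v => b (f t x) (frechet (g t) x v)))) => //.
  by move=> t x /(d t)[_ /esym].
apply: unif_CD => //.
  exact: (IH _ _ _ _ (fun t => frechet (f t)) g (bilin_lift_left E bb) fC (unif_CW gnC)).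
exact: (IH _ _ _ _ f (fun t => frechet (g t)) (bilin_lift_right E bb) (unif_CW fnC) gC).
Unshelve. all: by end_near. Qed.

Lemma blin_apply_bilin F G : bounded_bilin (fun (L : blin F G) (x : F) => L x).
Proof.
split=> [L|x|]; [exact: blin_linear | by move=> a L L' |].
by exists 1 => // L x; rewrite mul1r; exact: ler_blin.
Qed.

Lemma unif_C_post I E F G n (U : set E) (L : I -> blin F G) (M : R)
    (f : I -> E -> F) : open U -> (forall t, `|L t| <= M) ->
  unif_C n U f -> unif_C n U (fun t x => L t (f t x)).
Proof.
move=> oU LM fC.
exact: (unif_C_bilin oU (@blin_apply_bilin F G) (unif_C_cst _ _ LM) fC).
Qed.

Lemma unif_CB I E F n (U : set E) (f g : I -> E -> F) : open U ->
  unif_C n U f -> unif_C n U g -> unif_C n U (fun t x => f t x - g t x).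
Proof.
move=> oU fC gC; apply: unif_CD => //.
apply: (@unif_C_eq _ _ _ n U (fun t x => (- blin_id F) (g t x))) => //.
exact: (unif_C_post (L := fun _ => - blin_id F) oU (fun _ => lexx _) gC).
Qed.

(* Bounds along [u] instead of on a set: y_l(t) is in general unbounded in t. *)
Fixpoint bounded_along I E F G n (U : set E) (u : I -> E -> F)
    (phi : I -> F -> G) : Prop :=
  loc_ubounded U (fun t e => phi t (u t e)) /\
  match n with
  | 0 => True
  | n'.+1 => bounded_along n' U u (fun t => frechet (phi t))
  end.

(** By the chain rule the derivative is the product of [frechet (phi t)] along [u] and
    [frechet (u t)]: bounds enter on the derivatives of [u] only, whence [unif_dC]. *)
Lemma unif_C_comp I E F G n (U : set E) (V : set F) (u : I -> E -> F)
    (phi : I -> F -> G) : open U -> (forall t x, U x -> V (u t x)) ->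
  (forall t, class_C n V (phi t)) -> bounded_along n U u phi ->
  unif_dC n U u -> unif_C n U (fun t x => phi t (u t x)).
Proof.
move=> oU uV; elim: n G phi => [|n IH] G phi phiC bd udC;
  apply/unif_CE; split; [by case: bd| |by case: bd|].
  move=> t x Ux; apply: continuous_comp; first exact: udC.
  exact/phiC/uV.
(* [u] serves twice: at order [n] inside the derivative of [phi], and through [frechet (u t)] as the
   other factor. *)
have udC' := unif_dCW udC.
case: udC => ud uC.
have d t x : U x -> differentiable (fun x => phi t (u t x)) x /\
    frechet (fun x => phi t (u t x)) x =
    blin_comp (frechet (phi t) (u t x)) (frechet (u t) x).
  move=> Ux; apply/has_frechetP.
  apply: has_frechet_comp; apply/has_frechetP; split=> //; first exact: ud.
  by case: (phiC t) => + _; apply; exact: uV.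
split; first by move=> t x /(d t)[].
apply: (@unif_C_eq _ _ _ n U (fun t x => blin_comp (frechet (phi t) (u t x)) (frechet (u t) x))) => //.
  by move=> t x /(d t)[_ /esym].
apply: (unif_C_bilin oU (@blin_comp_bilin _ _ _ _)) => //.
apply: (IH _ (fun t => frechet (phi t))) => //; first by move=> t; case: (phiC t).
by case: bd.
Qed.

End UniformClass.

(** * Bounded functions and superposition operators *)

Section BoundedFunctions.
Context {R : realType}.
Implicit Types (I : pointedType) (F : normedModType R).

Definition bfun_pred I F : {pred I -> F} :=
  mem [set f : I -> F | exists M : R, forall t, `|f t| <= M].

Record bfun I F := Bfun {
  bfun_fun :> I -> F;
  bfun_funP : bfun_fun \in @bfun_pred I F }.

HB.instance Definition _ I F := [isSub for @bfun_fun I F].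
HB.instance Definition _ I F := [Choice of bfun I F by <:].

Lemma bfun_predP I F (f : I -> F) :
  reflect (exists M : R, forall t, `|f t| <= M) (f \in @bfun_pred I F).
Proof. by apply: (iffP idP); rewrite inE. Qed.

Fact bfun_submod_closed I F : submod_closed (@bfun_pred I F).
Proof.
split; first by apply/bfun_predP; exists 0 => t; rewrite normr0.
move=> a f g /bfun_predP[M fM] /bfun_predP[N gN]; apply/bfun_predP.
exists (`|a| * M + N) => t; rewrite (le_trans (ler_normD _ _))// lerD//.
by rewrite normrZ ler_wpM2l.
Qed.

HB.instance Definition _ I F :=
  GRing.SubChoice_isSubLmodule.Build R (I -> F) (@bfun_pred I F) (bfun I F)
    (GRing.submod_closed_semi (@bfun_submod_closed I F)).

Lemma bfunDE I F (f g : bfun I F) t : (f + g) t = f t + g t.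
Proof. by []. Qed.

Lemma bfunBE I F (f g : bfun I F) t : (f - g) t = f t - g t.
Proof. by []. Qed.

Lemma bfunZE I F (a : R) (f : bfun I F) t : (a *: f) t = a *: f t.
Proof. by []. Qed.

Lemma bfun_ext I F (f g : bfun I F) : f =1 g -> f = g.
Proof. by move=> fg; apply: val_inj; apply/funext. Qed.

(** [I] is pointed, so the set of norms is nonempty and its [sup] is a least upper bound. *)
Definition supnorm I F (f : bfun I F) : R := sup (range (fun t => `|f t|)).

Lemma ler_supnorm I F (f : bfun I F) t : `|f t| <= supnorm f.
Proof.
have /bfun_predP[M fM] := bfun_funP f.
by apply: ub_le_sup; [exists M => _ [s _ <-] | exists t].
Qed.

Lemma supnorm_le I F (f : bfun I F) M : (forall t, `|f t| <= M) -> supnorm f <= M.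
Proof.
move=> fM; apply: ge_sup; first by exists `|f point|; exists point.
by move=> _ [t _ <-].
Qed.

Fact ler_supnormD I F (f g : bfun I F) : supnorm (f + g) <= supnorm f + supnorm g.
Proof.
apply: supnorm_le => t; rewrite bfunDE (le_trans (ler_normD _ _))//.
by rewrite lerD// ler_supnorm.
Qed.

Fact supnormZ_le I F (a : R) (f : bfun I F) : supnorm (a *: f) <= `|a| * supnorm f.
Proof.
by apply: supnorm_le => t; rewrite bfunZE normrZ ler_wpM2l// ler_supnorm.
Qed.

Fact supnorm_ge0 I F (f : bfun I F) : 0 <= supnorm f.
Proof. by apply: le_trans (ler_supnorm f point). Qed.

Fact supnormZ I F (a : R) (f : bfun I F) : supnorm (a *: f) = `|a| * supnorm f.
Proof.
apply/eqP; rewrite eq_le supnormZ_le/=.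
have [->|a0] := eqVneq a 0; first by rewrite normr0 mul0r supnorm_ge0.
rewrite -ler_pdivlMl ?normr_gt0// -normfV.
by rewrite -[X in supnorm X <= _](scalerK a0) supnormZ_le.
Qed.

Fact supnorm_eq0 I F (f : bfun I F) : supnorm f = 0 -> f = 0.
Proof.
move=> f0; apply: bfun_ext => x; apply/eqP; rewrite -normr_le0.
by rewrite (le_trans (ler_supnorm f x))// f0.
Qed.

HB.instance Definition _ I F :=
  Lmodule_isNormed.Build R (bfun I F)
    (@ler_supnormD I F) (@supnormZ I F) (@supnorm_eq0 I F).

Lemma ler_bfun I F (f : bfun I F) t : `|f t| <= `|f|.
Proof. exact: ler_supnorm. Qed.

Lemma bfun_norm_le I F (f : bfun I F) M : (forall t, `|f t| <= M) -> `|f| <= M.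
Proof. exact: supnorm_le. Qed.

Definition mkbfun I F (f : I -> F) : bfun I F := insubd (0 : bfun I F) f.

Lemma mkbfunE I F (f : I -> F) : (exists M, forall t, `|f t| <= M) ->
  mkbfun f = f :> (I -> F).
Proof. by move=> /bfun_predP P; exact: (@insubdK _ _ (bfun I F) 0 _ P). Qed.

Definition bfun_eval I F (t : I) : blin (bfun I F) F := mkblin (fun f : bfun I F => f t).

Lemma bfun_evalE I F t (f : bfun I F) : bfun_eval F t f = f t.
Proof.
rewrite /bfun_eval mkblinE//; split=> //.
by exists 1 => g; rewrite mul1r ler_bfun.
Qed.

Lemma bfun_eval_norm I F (t : I) : `|bfun_eval F t| <= 1.
Proof. by apply: blin_norm_le => // f; rewrite mul1r bfun_evalE ler_bfun. Qed.

End BoundedFunctions.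

Section Nemytskii.
Context {R : realType}.
Implicit Types (E F G : normedModType R) (I : pointedType).

Lemma loc_ubounded_mkbfun I E F (U : set E) (g : I -> E -> F) e t :
  loc_ubounded U g -> U e -> mkbfun (fun t => g t e) t = g t e.
Proof.
move=> gb Ue; rewrite mkbfunE//; have [M gM] := gb e Ue.
by exists M; exact: nbhs_singleton gM.
Qed.

(** A bounded family of operators, acting index by index; this turns the family of derivatives into
    the derivative of the superposition operator. *)
Definition bfun_blin I E F (L : bfun I (blin E F)) : blin E (bfun I F) :=
  mkblin (fun v => mkbfun (fun t => L t v)).

Lemma bfun_blin_fun I E F (L : bfun I (blin E F)) v t :
  mkbfun (fun t => L t v) t = L t v.
Proof.
rewrite mkbfunE//; exists (`|L| * `|v|) => s.
by rewrite (le_trans (ler_blin _ _))// ler_wpM2r// ler_bfun.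
Qed.

Lemma bfun_blinE I E F (L : bfun I (blin E F)) v t : bfun_blin L v t = L t v.
Proof.
rewrite /bfun_blin mkblinE ?bfun_blin_fun//; split.
  move=> a u w; apply: bfun_ext => s.
  by rewrite bfunDE bfunZE !bfun_blin_fun linearP.
exists `|L| => w; apply: bfun_norm_le => s.
by rewrite bfun_blin_fun (le_trans (ler_blin _ _))// ler_wpM2r// ler_bfun.
Qed.

Lemma bfun_blin_bounded_lin I E F : bounded_lin (@bfun_blin I E F).
Proof.
split.
  move=> a L L'; apply: blin_ext => v; apply: bfun_ext => t.
  by rewrite blinDE blinZE bfunDE bfunZE !bfun_blinE.
exists 1 => L; rewrite mul1r; apply: blin_norm_le => // v.
apply: bfun_norm_le => t.
by rewrite bfun_blinE (le_trans (ler_blin _ _))// ler_wpM2r// ler_bfun.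
Qed.

Lemma near_segment E (Q : E -> Prop) (x : E) : (\forall y \near x, Q y) ->
  \forall h \near (0 : E), forall s : R, 0 <= s -> s <= 1 -> Q (x + s *: h).
Proof.
move=> /nbhs_ballP[d d0 dQ]; apply/nbhs_ballP; exists d => // h.
rewrite -ball_normE /ball_/= sub0r normrN => hd s s0 s1.
apply: dQ; rewrite -ball_normE /ball_/= opprD addNKr normrN normrZ ger0_norm//.
by rewrite (le_lt_trans _ hd)// ler_piMl.
Qed.

Lemma near_subr E (P : E -> Prop) (x : E) :
  (\forall h \near (0 : E), P h) -> \forall y \near x, P (y - x).
Proof. by rewrite (near_shift x) sub0r. Qed.

(** The mean value inequality with one constant for all indices. Whole segments are covered, because
    the estimate is applied to the derivatives inside a remainder. *)
Lemma unif_lipschitz I E F (U : set E) (g : I -> E -> F) x : open U ->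
  unif_C 1 U g -> U x ->
  exists2 M, 0 <= M & \forall h \near (0 : E), forall t (s : R), 0 <= s -> s <= 1 ->
    `|g t (x + s *: h) - g t x| <= M * `|h|.
Proof.
move=> oU [_ [gd [gb _]]] Ux; have [M gM] := gb x Ux.
have M0 : 0 <= M by apply: le_trans (nbhs_singleton gM point).
exists M => //.
have nU : \forall y \near x, U y by exact: open_nbhs_nbhs.
have nb : \forall y \near x, U y /\ forall t, `|frechet (g t) y| <= M.
  exact: filterI.
apply: filterS (near_segment nb) => h H t s s0 s1.
apply: mean_value_frechet => r r0 r1.
  by apply: gd; rewrite scalerA; have [] := H (r * s) (mulr_ge0 r0 s0) (mulr_ile1 r0 s0 r1 s1).
rewrite scalerA; have [_ /(_ t) HM] := H (r * s) (mulr_ge0 r0 s0) (mulr_ile1 r0 s0 r1 s1).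
rewrite (le_trans (ler_blin _ _))// ler_pM// normrZ ger0_norm//.
by rewrite ler_piMl.
Qed.

(** Here one order is spent: the bound on the first derivative gives a Lipschitz estimate uniform in
    the index, hence continuity in the sup norm. *)
Lemma nemytskii_continuous I E F (U : set E) (g : I -> E -> F) x : open U ->
  unif_C 1 U g -> U x ->
  {for x, continuous (fun e => mkbfun (fun t => g t e))}.
Proof.
move=> oU gC Ux; have [M M0 gM] := unif_lipschitz oU gC Ux.
have gb : loc_ubounded U g by case: gC.
apply/cvgrPdist_le => e e0.
have nU : \forall y \near x, U y by exact: open_nbhs_nbhs.
near=> y.
have Uy : U y by near: y.
have hM : forall t, `|g t y - g t x| <= M * `|y - x|.
  near: y; apply: filterS (near_subr x gM) => y H t.
  by have := H t 1 ler01 (lexx _); rewrite scale1r subrKC.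
have he : `|y - x| <= e / (M + 1).
  near: y; apply: (near_subr (P := fun h => `|h| <= _)); have /cvgr_norm_le := @cvg_id _ (nbhs (0 : E)); rewrite normr0; apply.
  by rewrite divr_gt0// ltr_wpDl.
apply: bfun_norm_le => t.
rewrite bfunBE !(loc_ubounded_mkbfun _ gb)// distrC (le_trans (hM t))//.
rewrite (le_trans (ler_wpM2l M0 he))// mulrCA ler_piMr// ?(ltW e0)//.
by rewrite ler_pdivrMr ?mul1r ?lerDl// ltr_wpDl.
Unshelve. all: by end_near. Qed.

(** Subtracting the linear part from [g t] leaves a map whose derivative on the segment is at most M
    |h|, by the second-order bound; the remainder is then at most M |h|^2 for all indices at
    once. *)
Lemma nemytskii_frechet I E F (U : set E) (g : I -> E -> F) x : open U ->
  unif_C 2 U g -> U x ->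
  has_frechet (fun e => mkbfun (fun t => g t e)) x
    (bfun_blin (mkbfun (fun t => frechet (g t) x))).
Proof.
move=> oU [gb [gd gC]] Ux e e0; have [M M0 gM] := unif_lipschitz oU gC Ux.
have g'b : loc_ubounded U (fun t => frechet (g t)) by case: gC.
have nU : \forall y \near x, U y by exact: open_nbhs_nbhs.
near=> h.
have Uxs : forall s : R, 0 <= s -> s <= 1 -> U (x + s *: h).
  by near: h; exact: near_segment nU.
have Uxh : U (x + h) by have := Uxs 1 ler01 (lexx _); rewrite scale1r.
have hM : forall t (s : R), 0 <= s -> s <= 1 ->
    `|frechet (g t) (x + s *: h) - frechet (g t) x| <= M * `|h| by near: h.
have he : `|h| <= e / (M + 1).
  near: h; have /cvgr_norm_le := @cvg_id _ (nbhs (0 : E)); rewrite normr0; apply.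
  by rewrite divr_gt0// ltr_wpDl.
apply: bfun_norm_le => t.
rewrite !bfunBE bfun_blinE !(loc_ubounded_mkbfun _ gb)// (loc_ubounded_mkbfun _ g'b)//.
pose phi y := g t y + (- frechet (g t) x) y.
have dphi y : U y -> differentiable phi y /\
    frechet phi y = frechet (g t) y - frechet (g t) x.
  move=> Uy; apply/has_frechetP; apply: has_frechetD; last exact: has_frechet_blin.
  by apply/has_frechetP; split=> //; exact: gd.
have -> : g t (x + h) - g t x - frechet (g t) x h = phi (x + h) - phi x.
  rewrite /phi -[(- frechet (g t) x) _]/(- (frechet (g t) x (x + h))).
  rewrite -[(- frechet (g t) x) x]/(- (frechet (g t) x x)) linearD !opprD opprK.
  by rewrite !addrA [RHS](ACl (1*4*3*2*5))/= subrK.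
have He : (M * `|h|) * `|h| <= e * `|h|.
  rewrite ler_wpM2r// (le_trans (ler_wpM2l M0 he))// mulrCA ler_piMr// ?(ltW e0)//.
  by rewrite ler_pdivrMr ?mul1r ?lerDl// ltr_wpDl.
apply: le_trans He; apply: mean_value_frechet => s s0 s1.
  by case: (dphi _ (Uxs s s0 s1)).
case: (dphi _ (Uxs s s0 s1)) => _ ->.
by rewrite (le_trans (ler_blin _ _))// ler_wpM2r// hM.
Unshelve. all: by end_near. Qed.

Lemma class_C_eq E F n (U : set E) (f g : E -> F) : open U ->
  (forall x, U x -> f x = g x) -> class_C n U f -> class_C n U g.
Proof.
move=> oU fg /class_C_unif fC.
exact: (unif_C_class tt (unif_C_eq (g' := fun _ => g) oU (fun _ => fg) fC)).
Qed.

Lemma class_C_post E F G n (U : set E) (L : blin F G) (f : E -> F) : open U ->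
  class_C n U f -> class_C n U (fun x => L (f x)).
Proof.
move=> oU /class_C_unif fC.
exact: (unif_C_class tt (unif_C_post (L := fun _ => L) oU (fun _ => lexx _) fC)).
Qed.

(** The derivative is a fixed bounded operator applied to the superposition operator of the derived
    family, so the induction loses an order only in its base case. *)
Lemma class_C_nemytskii I E F n (U : set E) (g : I -> E -> F) : open U ->
  unif_C n.+1 U g -> class_C n U (fun e => mkbfun (fun t => g t e)).
Proof.
move=> oU; elim: n F g => [|n IH] F g gC.
  by move=> x Ux; exact: nemytskii_continuous gC Ux.
have gC2 : unif_C 2 U g.
  by elim: n {IH} gC => // n IH gC; apply: IH; exact: unif_CW.
have d x : U x -> differentiable (fun e => mkbfun (fun t => g t e)) x /\
    frechet (fun e => mkbfun (fun t => g t e)) x =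
    bfun_blin (mkbfun (fun t => frechet (g t) x)).
  by move=> Ux; apply/has_frechetP; exact: (nemytskii_frechet oU gC2 Ux).
split; first by move=> x /d[].
pose J : blin (bfun I (blin E F)) (blin E (bfun I F)) := mkblin (@bfun_blin I E F).
have JE L : J L = bfun_blin L by rewrite /J mkblinE//; exact: bfun_blin_bounded_lin.
case: gC => _ [_ gC].
apply: (class_C_eq (f := fun x => J (mkbfun (fun t => frechet (g t) x)))) => //.
  by move=> x /d[_ ->]; rewrite JE.
exact: (class_C_post J oU (IH _ (fun t => frechet (g t)) gC)).
Qed.

End Nemytskii.

(** * Sequential completeness of spaces of functions and operators *)

Section Completeness.
Context {R : realType}.
Implicit Types (E F : normedModType R) (I : pointedType).

(* A predicate, so that the induction over B, blin Lam B, ... needs no complete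
   structure on these types. *)
Definition seq_complete F := forall u : nat -> F,
  (forall e : R, 0 < e -> exists N, forall n m, (N <= n)%N -> (N <= m)%N ->
    `|u n - u m| <= e) ->
  exists l, forall e : R, 0 < e -> exists N, forall n, (N <= n)%N -> `|u n - l| <= e.

Lemma completeNormedModType_seq_complete (X : completeNormedModType R) :
  seq_complete X.
Proof.
move=> u uC.
have /cvg_ex[/= l ul] : cvg (u @ \oo).
  apply: cauchy_cvg; apply: cauchy_exP => e e0.
  have e20 : 0 < e / 2 by rewrite divr_gt0.
  have [N uN] := uC (e / 2) e20.
  exists (u N); exists N => // n /= Nn.
  rewrite -ball_normE /ball_/= (le_lt_trans (uN N n _ _))//.
  by rewrite ltr_pdivrMr// ltr_pMr// ltr1n.
exists l => e e0; have /cvgr_distC_le/(_ e e0)[N _ NH] := ul.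
by exists N => n Nn; exact: NH.
Qed.

Lemma norm_le_eps F (x : F) (K : R) :
  (forall e, 0 < e -> `|x| <= e * K) -> x = 0.
Proof.
move=> H; apply/eqP; rewrite -normr_le0; apply/ler_addgt0Pr => e e0; rewrite add0r.
have K0 : 0 < `|K| + 1 by rewrite ltr_wpDl.
apply: le_trans (H _ (divr_gt0 e0 K0)) _.
rewrite -mulrA ler_piMr ?(ltW e0)// mulrC ler_pdivrMr// mul1r.
by rewrite (le_trans (ler_norm K))// lerDl.
Qed.

(** Pointwise limits inherit the Cauchy estimate. Weight 1 serves bounded functions in the sup norm,
    weight |v| serves operators in the operator norm. *)
Lemma weighted_limit (T : Type) F (w : T -> R) (u : nat -> T -> F) :
  seq_complete F -> (forall t, 0 <= w t) ->
  (forall e : R, 0 < e -> exists N, forall n m, (N <= n)%N -> (N <= m)%N ->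
    forall t, `|u n t - u m t| <= e * w t) ->
  exists l, forall e : R, 0 < e -> exists N, forall n, (N <= n)%N ->
    forall t, `|u n t - l t| <= e * w t.
Proof.
move=> Fc w0 uC.
have lim t : exists l, forall e : R, 0 < e -> exists N, forall n, (N <= n)%N ->
    `|u n t - l| <= e.
  apply: Fc => e e0.
  have w1 : 0 < w t + 1 by rewrite ltr_wpDl.
  have [N uN] := uC _ (divr_gt0 e0 w1); exists N => n m Nn Nm.
  apply: le_trans (uN n m Nn Nm t) _.
  by rewrite mulrAC ler_pdivrMr// ler_wpM2l ?lerDl// ltW.
have [l lP] := choice lim; exists l => e e0.
have [N uN] := uC e e0; exists N => n Nn t.
apply/ler_addgt0Pr => d d0.
have [N' lN'] := lP t d d0.
have := lN' (maxn N N') (leq_maxr _ _).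
have := uN n (maxn N N') Nn (leq_maxl _ _) t.
move=> h1 h2; rewrite -(subrKA (u (maxn N N') t)).
by rewrite (le_trans (ler_normD _ _))// lerD.
Qed.

Lemma bfun_seq_complete I F : seq_complete F -> seq_complete (bfun I F).
Proof.
move=> Fc u uC.
have [|e e0|l lP] := @weighted_limit I F (cst 1) (fun n t => u n t) Fc.
- by move=> t; exact: ler01.
- have [N uN] := uC e e0; exists N => n m Nn Nm t; rewrite mulr1 -bfunBE.
  by rewrite (le_trans (ler_bfun _ _))// uN.
have lb : exists M, forall t, `|l t| <= M.
  have [N lN] := lP 1 ltr01; exists (`|u N| + 1) => t.
  rewrite -(subKr (u N t) (l t)) (le_trans (ler_normB _ _))// lerD ?ler_bfun//.
  by have := lN N (leqnn _) t; rewrite mulr1.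
exists (mkbfun l) => e e0; have [N lN] := lP e e0; exists N => n Nn.
apply: bfun_norm_le => t; rewrite bfunBE mkbfunE//.
by have := lN n Nn t; rewrite mulr1.
Qed.

Lemma blin_seq_complete E F : seq_complete F -> seq_complete (blin E F).
Proof.
move=> Fc u uC.
have [|e e0|l lP] := @weighted_limit E F (fun v => `|v|) (fun n t => u n t) Fc.
- by move=> v; exact: normr_ge0.
- have [N uN] := uC e e0; exists N => n m Nn Nm t; rewrite -blinBE.
  by rewrite (le_trans (ler_blin _ _))// ler_wpM2r// uN.
have lb : bounded_lin l.
  split; last first.
    have [N lN] := lP 1 ltr01; exists (`|u N| + 1) => t.
    rewrite -(subKr (u N t) (l t)) (le_trans (ler_normB _ _))// mulrDl lerD ?ler_blin//.
    exact: lN.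
  (* Since [u N] is linear, the defect of linearity of [l] is a combination of three errors of
     approximation. *)
  move=> a v w; apply/subr0_eq.
  apply: (@norm_le_eps _ _ (`|a *: v + w| + `|a| * `|v| + `|w|)) => e e0.
  have [N lN] := lP e e0; have {}lN := lN N (leqnn _).
  have -> : l (a *: v + w) - (a *: l v + l w) =
    - (u N (a *: v + w) - l (a *: v + w)) + a *: (u N v - l v) + (u N w - l w).
    rewrite (blin_linear (u N)) opprB scalerBr !opprD !addrA.
    by rewrite [RHS](ACl (1*5*7*4*2*6*3))/= addrK addrK.
  rewrite !mulrDr (le_trans (ler_normD _ _))// lerD//.
  rewrite (le_trans (ler_normD _ _))// lerD ?normrN//.
  by rewrite normrZ mulrCA ler_wpM2l.
exists (mkblin l) => e e0; have [N lN] := lP e e0; exists N => n Nn.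
apply: blin_norm_le => [|t]; first exact: ltW.
by rewrite blinBE mkblinE// lN.
Qed.

End Completeness.

(** * Implicit equations given by a linear graph *)

Section ClassCalculus.
Context {R : realType}.
Implicit Types E F G H : normedModType R.

Lemma class_CD E F n (U : set E) (f g : E -> F) : open U ->
  class_C n U f -> class_C n U g -> class_C n U (fun x => f x + g x).
Proof.
move=> oU /class_C_unif fC /class_C_unif gC.
exact: (unif_C_class tt (unif_CD oU fC gC)).
Qed.

Lemma class_C_bilin E F G H n (U : set E) (b : F -> G -> H)
    (f : E -> F) (g : E -> G) : open U -> bounded_bilin b ->
  class_C n U f -> class_C n U g -> class_C n U (fun x => b (f x) (g x)).
Proof.
move=> oU bb /class_C_unif fC /class_C_unif gC.
exact: (unif_C_class tt (unif_C_bilin oU bb fC gC)).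
Qed.

Lemma class_C_lin E F n (U : set E) (L : blin E F) : class_C n U L.
Proof.
exact: (unif_C_class tt (unif_C_lin n U (L := fun _ => L) (fun _ => lexx _))).
Qed.

Lemma class_C_cst E F n (U : set E) (a : F) : class_C n U (fun _ => a).
Proof.
exact: (unif_C_class tt (unif_C_cst n U (a := fun _ => a) (fun _ => lexx _))).
Qed.

Lemma class_C_comp E F G n (U : set E) (V : set F) (u : E -> F) (phi : F -> G) :
  open U -> (forall x, U x -> V (u x)) -> class_C n U u -> class_C n V phi ->
  class_C n U (fun x => phi (u x)).
Proof.
move=> oU uV uC phiC.
have bd : bounded_along n U (fun _ : unit => u) (fun _ => phi).
  have uc := class_C_continuous uC.
  elim: n G phi phiC {uC} => [|n IH] G phi phiC; split => //.
  - apply: continuous_loc_ubounded => x Ux; apply: continuous_comp; first exact: uc.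
    exact/phiC/uV.
  - apply: continuous_loc_ubounded => x Ux; apply: continuous_comp; first exact: uc.
    exact/(class_C_continuous phiC)/uV.
  - by apply: IH; case: phiC.
have /unif_CE[_ uC'] := class_C_unif uC.
exact: (unif_C_class tt (unif_C_comp oU (fun _ => uV) (fun _ => phiC) bd uC')).
Qed.

Lemma blin_fst_bounded E F : bounded_lin (fst : (E * F)%type -> E).
Proof. by split=> //; exists 1 => p; rewrite mul1r prod_normE le_max lexx. Qed.

Lemma blin_snd_bounded E F : bounded_lin (snd : (E * F)%type -> F).
Proof. by split=> //; exists 1 => p; rewrite mul1r prod_normE le_max lexx orbT. Qed.

Lemma blin_inl_bounded E F : bounded_lin (fun x : E => (x, 0) : (E * F)%type).
Proof.
split=> [a x y|]; first by rewrite -[RHS]/(a *: x + y, a *: 0 + 0) scaler0 addr0.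
by exists 1 => p; rewrite mul1r prod_normE/= normr0 ge_max lexx normr_ge0.
Qed.

Lemma blin_inr_bounded E F : bounded_lin (fun x : F => (0, x) : (E * F)%type).
Proof.
split=> [a x y|]; first by rewrite -[RHS]/(a *: 0 + 0, a *: x + y) scaler0 addr0.
by exists 1 => p; rewrite mul1r prod_normE/= normr0 ge_max lexx normr_ge0.
Qed.

Definition blin_fst E F : blin (E * F)%type E := mkblin fst.
Definition blin_snd E F : blin (E * F)%type F := mkblin snd.
Definition blin_inl E F : blin E (E * F)%type := mkblin (fun x => (x, 0)).
Definition blin_inr E F : blin F (E * F)%type := mkblin (fun x => (0, x)).

Lemma blin_fstE E F p : blin_fst E F p = p.1.
Proof. by rewrite /blin_fst mkblinE//; exact: blin_fst_bounded. Qed.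

Lemma blin_sndE E F p : blin_snd E F p = p.2.
Proof. by rewrite /blin_snd mkblinE//; exact: blin_snd_bounded. Qed.

Lemma blin_inlE E F x : blin_inl E F x = (x, 0).
Proof. by rewrite /blin_inl mkblinE//; exact: blin_inl_bounded. Qed.

Lemma blin_inrE E F x : blin_inr E F x = (0, x).
Proof. by rewrite /blin_inr mkblinE//; exact: blin_inr_bounded. Qed.

Lemma blin_pairE E F (x : E) (y : F) : blin_inl E F x + blin_inr E F y = (x, y).
Proof.
rewrite blin_inlE blin_inrE -[LHS]/(x + 0, 0 + y).
by rewrite addr0 add0r.
Qed.

Lemma norm_pair_le E F (x : E) (y : F) : `|(x, y) : (E * F)%type| <= `|x| + `|y|.
Proof. by rewrite prod_normE/= ge_max lerDl lerDr !normr_ge0. Qed.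

Lemma open_setXT E F (U : set E) : open U -> open (U `*` setT : set (E * F)%type).
Proof.
move=> oU; rewrite (_ : _ `*` _ = (fst : (E * F)%type -> E) @^-1` U).
  by apply: open_comp => // x _; exact: cvg_fst.
by apply/seteqP; split=> x // [].
Qed.

End ClassCalculus.

Section LinearGraphs.
Context {R : realType}.
Implicit Types (E B : normedModType R).

(** A relation rather than an operator: z' - A z makes sense only for some bounded functions z and
    is not bounded in the sup norm of z. *)
Definition graph_linear B (Gam : B -> B -> Prop) := forall a z h z' h',
  Gam z h -> Gam z' h' -> Gam (a *: z + z') (a *: h + h').

Definition graph_bounded B (Gam : B -> B -> Prop) (kap : R) :=
  forall z h, Gam z h -> `|z| <= kap * `|h|.

(* Limits of difference quotients are only known to lie in the closure of the
   graph; working there avoids proving that the graph is closed. *)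
Definition gclosure B (Gam : B -> B -> Prop) z h := forall e : R, 0 < e ->
  exists z' h', [/\ Gam z' h', `|z - z'| <= e & `|h - h'| <= e].

Lemma gclosure_linear B (Gam : B -> B -> Prop) :
  graph_linear Gam -> graph_linear (gclosure Gam).
Proof.
move=> GL a z h z' h' zh zh' e e0.
have a1 : 0 < `|a| + 1 by rewrite ltr_wpDl.
have ea : 0 < e / (`|a| + 1) by rewrite divr_gt0.
have [u [k [uk zu hk]]] := zh _ ea.
have [u' [k' [uk' zu' hk']]] := zh' _ ea.
exists (a *: u + u'), (a *: k + k'); split; first exact: GL.
  rewrite opprD addrACA -scalerBr (le_trans (ler_normD _ _))// normrZ.
  rewrite (le_trans (lerD (ler_wpM2l (normr_ge0 a) zu) zu'))//.
  by rewrite -[X in _ + X]mul1r -mulrDl mulrC divfK// gt_eqF.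
rewrite opprD addrACA -scalerBr (le_trans (ler_normD _ _))// normrZ.
rewrite (le_trans (lerD (ler_wpM2l (normr_ge0 a) hk) hk'))//.
by rewrite -[X in _ + X]mul1r -mulrDl mulrC divfK// gt_eqF.
Qed.

Lemma gclosure_bounded B (Gam : B -> B -> Prop) kap : 0 <= kap ->
  graph_bounded Gam kap -> graph_bounded (gclosure Gam) kap.
Proof.
move=> kap0 GB z h zh; apply/ler_addgt0Pr => e e0.
have k1 : 0 < kap + 1 by rewrite ltr_wpDl.
have [u [k [/GB uk zu hk]]] := zh _ (divr_gt0 e0 k1).
have -> : e = kap * (e / (kap + 1)) + e / (kap + 1).
  by rewrite -[X in _ + X]mul1r -mulrDl mulrC divfK// gt_eqF.
rewrite [leRHS]addrA -[z](subrK u) (le_trans (ler_normD _ _))//.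
rewrite [leRHS]addrC lerD//.
rewrite (le_trans uk)// -mulrDr ler_wpM2l//.
by rewrite -{1}[k](subKr h) (le_trans (ler_normB _ _))// lerD2l.
Qed.

End LinearGraphs.

(** Difference quotients in the second variable are at most c |v|, and for each [e] one small [s]
    brings the quotient within [e] of the derivative. *)
Lemma partial_lipschitz {R : realType} (E F G : normedModType R) (N : E * F -> G)
    (l : E) (x : F) (c : R) (DN : blin (E * F)%type G) :
  (forall u v, `|N (l, u) - N (l, v)| <= c * `|u - v|) ->
  has_frechet N (l, x) DN -> forall v, `|DN (0, v)| <= c * `|v|.
Proof.
move=> NLip ND v; apply/ler_addgt0Pr => e e0.
have v1 : 0 < `|v| + 1 by rewrite ltr_wpDl.
have := ND _ (divr_gt0 e0 v1).
move=> /(near_scale0 ((0, v) : E * F) 0)/nbhs_ballP[d /= d0 H].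
pose s := d / 2.
have s0 : 0 < s by rewrite divr_gt0.
have sd : ball 0 d s.
  rewrite -ball_normE /ball_/= sub0r normrN gtr0_norm// ltr_pdivrMr//.
  by rewrite ltr_pMr// ltr1n.
have := H _ sd; rewrite subr0.
have -> : s *: ((0, v) : E * F) = (0, s *: v).
  by rewrite -[LHS]/(s *: 0, s *: v) scaler0.
have -> : (l, x) + ((0, s *: v) : E * F) = (l, x + s *: v).
  by rewrite -[LHS]/(l + 0, x + s *: v) addr0.
move=> H1; have := NLip (x + s *: v) x; rewrite [x + _]addrC addrK.
rewrite [s *: v + x]addrC => H2.
have : s * `|DN (0, v)| <= s * (c * `|v| + e).
  have -> : s * `|DN (0, v)| = `|DN (0, s *: v)|.
    have -> : (0, s *: v) = s *: ((0, v) : E * F).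
      by rewrite -[RHS]/(s *: 0, s *: v) scaler0.
    by rewrite linearZ normrZ gtr0_norm.
  rewrite -(subKr (N (l, x + s *: v) - N (l, x)) (DN _)).
  rewrite (le_trans (ler_normB _ _))// mulrDr lerD//.
    by rewrite (le_trans H2)// normrZ gtr0_norm// mulrCA.
  rewrite (le_trans H1)// prod_normE/= normr0 max_r// normrZ gtr0_norm//.
  rewrite mulrCA ler_wpM2l ?(ltW s0)// mulrAC ler_pdivrMr// ler_wpM2l ?(ltW e0)//.
  by rewrite lerDl.
by rewrite ler_pM2l.
Qed.

Section GraphImplicit.
Context {R : realType} {Lam B : normedModType R}.
Context (Sigma : set Lam) (oSigma : open Sigma) (Bc : seq_complete B).
Context (Gam : B -> B -> Prop) (kap c : R) (kap0 : 0 <= kap) (c0 : 0 <= c)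
  (kc : kap * c < 1).
Context (GL : graph_linear Gam) (GB : graph_bounded Gam kap).
Context (N : Lam * B -> B) (z : Lam -> B).
Context (NLip : forall l u v, Sigma l -> `|N (l, u) - N (l, v)| <= c * `|u - v|).
Context (zN : forall l, Sigma l -> Gam (z l) (N (l, z l))).

Lemma graph_linearB (G : B -> B -> Prop) u h u' h' :
  graph_linear G -> G u h -> G u' h' -> G (u - u') (h - h').
Proof. by move=> Gl uh uh'; have := Gl (-1) _ _ _ _ uh' uh; rewrite !scaleN1r (addrC (- u')) (addrC (- h')). Qed.

(** Absorption: the share kap c |x| of the right-hand side is moved to the left, where 1 - kap c is
    positive. *)
Lemma contraction_bound (x : B) (h a : R) :
  `|x| <= kap * h -> h <= c * `|x| + a -> `|x| <= kap * a / (1 - kap * c).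
Proof.
move=> xh ha; rewrite ler_pdivlMr ?subr_gt0// mulrBr mulr1 lerBlDr.
rewrite (le_trans xh)// (le_trans (ler_wpM2l kap0 ha))// mulrDr addrC lerD2l.
by rewrite mulrA mulrC.
Qed.

(** The difference of two solutions lies in the graph over N(m, z m) - N(l, z l). Passing through
    N(m, z l) leaves a Lipschitz part, which is absorbed, and a part that is small by continuity of
    [N] in the parameter. *)
Lemma graph_solution_continuous :
  (forall l u, Sigma l -> {for (l, u), continuous N}) ->
  forall l, Sigma l -> {for l, continuous z}.
Proof.
move=> Nc l Sl.
have c1 : {for l, continuous (fun m => N (m, z l))}.
  apply: (@continuous_comp _ _ _ (fun m => (m, z l)) N); last exact: Nc.
  by apply: cvg_pair; [exact: cvg_id | exact: cvg_cst].
apply/cvgrPdist_le => e e0.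
have q0 : 0 < 1 - kap * c by rewrite subr_gt0.
have k1 : 0 < kap + 1 by rewrite ltr_wpDl.
have e1 : 0 < e * (1 - kap * c) / (kap + 1) by rewrite divr_gt0// mulr_gt0.
have /cvgr_distC_le/(_ _ e1) c2 := c1.
have nS : \forall m \near l, Sigma m by exact: open_nbhs_nbhs.
near=> m.
have Sm : Sigma m by near: m.
have hm : `|N (m, z l) - N (l, z l)| <= e * (1 - kap * c) / (kap + 1) by near: m.
rewrite distrC.
apply: le_trans (contraction_bound (GB (graph_linearB GL (zN Sm) (zN Sl)))
  (a := e * (1 - kap * c) / (kap + 1)) _) _.
  rewrite -(subrKA (N (m, z l))) (le_trans (ler_normD _ _))// lerD//.
  exact: NLip.
rewrite ler_pdivrMr// mulrCA ler_piMr ?mulr_ge0 ?(ltW e0) ?(ltW q0)//.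
by rewrite ler_pdivrMr// mul1r lerDl.
Unshelve. all: by end_near. Qed.

Context (l : Lam) (Sl : Sigma l) (DN : blin (Lam * B)%type B).
Context (ND : has_frechet N (l, z l) DN) (zc : {for l, continuous z}).

Let DN_le v : `|DN (0, v)| <= c * `|v|.
Proof. exact: partial_lipschitz (fun u v => @NLip l u v Sl) ND v. Qed.

Lemma DN_pair v w : DN (v, w) = DN (v, 0) + DN (0, w).
Proof.
rewrite -linearD; congr (DN _).
by rewrite -[RHS]/(v + 0, 0 + w) addr0 add0r.
Qed.

Let q := 1 - kap * c.
Let q0 : 0 < q. Proof. by rewrite subr_gt0. Qed.
Let dz v := z (l + v) - z l.
Let dN v := N (l + v, z (l + v)) - N (l, z l).

(** By [zc] the pair (v, dz v) tends to 0, so the expansion of [N] applies along [z]. Its error is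
    measured by |v| + |dz v| until [near_dz] bounds the second term by the first. *)
Lemma near_expansion (e : R) : 0 < e -> \forall v \near (0 : Lam),
  Sigma (l + v) /\ `|dN v - DN (v, dz v)| <= e * (`|v| + `|dz v|).
Proof.
move=> e0.
have nS : \forall v \near (0 : Lam), Sigma (l + v).
  by apply: near_addr0; exact: open_nbhs_nbhs.
have dz0 : dz @ (0 : Lam) --> (0 : B).
  rewrite -(subrr (z l)); apply: cvgB; last exact: cvg_cst.
  rewrite -[X in z X](addr0 l).
  apply: (@continuous_comp _ _ _ (fun v => l + v) z 0); last by rewrite addr0.
  by apply: cvgD; [exact: cvg_cst | exact: cvg_id].
have : (fun v => (v, dz v)) @ (0 : Lam) --> ((0, 0) : Lam * B).
  by apply: cvg_pair; [exact: cvg_id | exact: dz0].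
move=> /(_ _ (ND e0)) H; near=> v; split; first by near: v.
have : `|N ((l, z l) + ((v, dz v) : Lam * B)) - N (l, z l) - DN (v, dz v)| <=
   e * `|((v, dz v) : Lam * B)| by near: v.
have -> : (l, z l) + ((v, dz v) : Lam * B) = (l + v, z (l + v)).
  by rewrite -[LHS]/(l + v, z l + dz v) /dz subrKC.
move=> /le_trans; apply; rewrite ler_wpM2l// ?norm_pair_le//; exact: ltW.
Unshelve. all: by end_near. Qed.

(** With this choice of [e] the expansion error consumes at most half of q = 1 - kap c; the other
    half still absorbs |dz v|, which explains the factor 2 / q. *)
Lemma near_dz : exists2 K, 0 <= K & \forall v \near (0 : Lam), `|dz v| <= K * `|v|.
Proof.
have k2 : 0 < 2 * (kap + 1) by rewrite mulr_gt0// ltr_wpDl.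
pose e := q / (2 * (kap + 1)).
have e0 : 0 < e by rewrite divr_gt0.
have ke : kap * e <= q / 2.
  rewrite /e mulrCA ler_wpM2l ?(ltW q0)// ler_pdivrMr//.
  by rewrite mulKf ?lerDl.
exists (kap * (`|DN| + e) * (2 / q)).
  by rewrite mulr_ge0 ?divr_ge0 ?(ltW q0)// mulr_ge0 ?addr_ge0 ?(ltW e0).
near=> v.
have [Slv H] : Sigma (l + v) /\ `|dN v - DN (v, dz v)| <= e * (`|v| + `|dz v|).
  by near: v; exact: near_expansion.
have H1 := GB (graph_linearB GL (zN Slv) (zN Sl)).
rewrite -/(dz v) -/(dN v) in H1.
have H2 : `|dN v| <= `|DN| * `|v| + c * `|dz v| + e * (`|v| + `|dz v|).
  rewrite -[dN v](subrK (DN (v, dz v))) addrC (le_trans (ler_normD _ _))// lerD//.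
  rewrite DN_pair (le_trans (ler_normD _ _))// lerD ?DN_le//.
  rewrite (le_trans (ler_blin _ _))// ler_wpM2l//.
  by rewrite prod_normE/= normr0 max_l.
have {H1 H2} : `|dz v| <= kap * (`|DN| * `|v| + c * `|dz v| + e * (`|v| + `|dz v|)).
  by rewrite (le_trans H1)// ler_wpM2l.
have : kap * e * `|dz v| <= q / 2 * `|dz v| by rewrite ler_wpM2r.
have -> : kap * (`|DN| + e) * (2 / q) * `|v| = 2 * kap * (`|DN| + e) * `|v| / q by ring.
rewrite ler_pdivlMr// /q; move: (`|dz v|) (`|v|) (`|DN|) => a b d.
by move=> *; lra.
Unshelve. all: by end_near. Qed.

(** [kap / q] comes from absorption, the factor 2 from the defects of the two solutions compared. *)
Let K2 := 2 * kap / q.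

Lemma near_expansion_lin (e : R) : 0 < e -> \forall v \near (0 : Lam),
  Sigma (l + v) /\ `|dN v - DN (v, dz v)| <= e * `|v|.
Proof.
move=> e0; have [K K0 Kz] := near_dz.
have K1 : 0 < 1 + K by rewrite ltr_wpDr.
have := near_expansion (divr_gt0 e0 K1); move=> H; near=> v.
have [? H1] : Sigma (l + v) /\ `|dN v - DN (v, dz v)| <= e / (1 + K) * (`|v| + `|dz v|).
  by near: v.
have H2 : `|dz v| <= K * `|v| by near: v.
split=> //; rewrite (le_trans H1)// mulrAC ler_pdivrMr// -mulrA ler_wpM2l ?(ltW e0)//.
by rewrite mulrDr mulr1 lerD// mulrC.
Unshelve. all: by end_near. Qed.

(** Difference quotients solve the linearised equation up to a defect e |v|. The radius [d] does not
    depend on the direction [v], which later gives a Frechet derivative and not merely directional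
    ones. *)
Lemma quotient_expansion (e : R) : 0 < e -> exists2 d, 0 < d &
  forall v (s : R), 0 < s -> `|s *: v| < d ->
  exists h, Gam (s^-1 *: dz (s *: v)) h /\
    `|h - DN (v, s^-1 *: dz (s *: v))| <= e * `|v|.
Proof.
move=> e0; have /nbhs_ballP[d d0 H] := near_expansion_lin e0.
exists d => // v s s0 svd.
have [|Slv Hs] := H (s *: v); first by rewrite -ball_normE /ball_/= sub0r normrN.
have G0 : Gam 0 0.
  by have := graph_linearB GL (zN Sl) (zN Sl); rewrite !subrr.
exists (s^-1 *: dN (s *: v)); split.
  have := GL s^-1 (graph_linearB GL (zN Slv) (zN Sl)) G0.
  by rewrite !addr0.
have -> : DN (v, s^-1 *: dz (s *: v)) = s^-1 *: DN (s *: v, dz (s *: v)).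
  rewrite -linearZ; congr (DN _).
  by rewrite -[RHS]/(s^-1 *: (s *: v), s^-1 *: dz (s *: v)) scalerA mulVf ?scale1r// gt_eqF.
rewrite -scalerBr normrZ gtr0_norm ?invr_gt0// ler_pdivrMl// (le_trans Hs)//.
by rewrite normrZ gtr0_norm// mulrCA.
Qed.

(** The difference solves the equation for the direction 0 up to the sum of the defects, and [DN] is
    c-Lipschitz there. The closure admits quotients and their limits alike. *)
Lemma approx_solutions_close (v : Lam) (u u' h h' : B) (a : R) :
  gclosure Gam u h -> gclosure Gam u' h' ->
  `|h - DN (v, u)| <= a -> `|h' - DN (v, u')| <= a -> `|u - u'| <= K2 * a.
Proof.
move=> uh uh' ha ha'.
have H1 := gclosure_bounded kap0 GB (graph_linearB (gclosure_linear GL) uh uh').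
have : `|u - u'| <= kap * (a + a) / q.
  apply: contraction_bound H1 _.
  have -> : h - h' = DN (0, u - u') + (h - DN (v, u) - (h' - DN (v, u'))).
    have -> : DN (0, u - u') = DN (v, u) - DN (v, u').
      rewrite -linearB; congr (DN _).
      by rewrite -[RHS]/(v - v, u - u') subrr.
    by rewrite opprB !addrA [RHS](ACl (3*6*1*4*5*2))/= !addrK.
  rewrite (le_trans (ler_normD _ _))// lerD ?DN_le//.
  by rewrite (le_trans (ler_normB _ _))// lerD.
by move=> /le_trans; apply; rewrite /K2 le_eqVlt; apply/orP; left; apply/eqP; ring.
Qed.

Lemma gclosure_sub (u h : B) : Gam u h -> gclosure Gam u h.
Proof. by move=> uh e e0; exists u, h; split=> //; rewrite subrr normr0 ltW. Qed.

Lemma K2_ge0 : 0 <= K2.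
Proof. by rewrite /K2 divr_ge0 ?(ltW q0)// mulr_ge0. Qed.

(** By [approx_solutions_close] the quotients along 1 / (n + 1) are Cauchy, and the linearised
    equation has at most one solution in each direction. This uniqueness makes the limit linear in
    the direction. *)
Lemma graph_solution_frechet : exists L : blin Lam B, has_frechet z l L /\
  forall v, gclosure Gam (L v) (DN (v, L v)).
Proof.
pose s n : R := n.+1%:R^-1.
have s0 n : 0 < s n by rewrite invr_gt0 ltr0n.
pose w n v := (s n)^-1 *: dz (s n *: v).
have small (v : Lam) (d : R) : 0 < d -> exists M, forall n, (M <= n)%N -> `|s n *: v| < d.
  move=> d0; exists (Num.bound (`|v| / d)) => n Mn.
  rewrite normrZ gtr0_norm// /s mulrC ltr_pdivrMr// mulrC -ltr_pdivrMr//.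
  apply: (lt_le_trans (archi_boundP _)); first by rewrite divr_ge0// ltW.
  by rewrite ler_nat (leq_trans Mn).
have qe e (e0 : 0 < e) := quotient_expansion e0.
have lim v : exists x, forall e : R, 0 < e -> exists M, forall n, (M <= n)%N -> `|w n v - x| <= e.
  apply: Bc => e e0.
  have k1 : 0 < (K2 + 1) * (`|v| + 1) by rewrite mulr_gt0// ltr_wpDl// K2_ge0.
  have [d d0 Hd] := qe _ (divr_gt0 e0 k1).
  have [M HM] := small v d d0; exists M => n m Mn Mm.
  have [h [wh hD]] := Hd v (s n) (s0 n) (HM n Mn).
  have [h' [wh' hD']] := Hd v (s m) (s0 m) (HM m Mm).
  apply: le_trans (approx_solutions_close (gclosure_sub wh) (gclosure_sub wh') hD hD') _.
  have -> : K2 * (e / ((K2 + 1) * (`|v| + 1)) * `|v|) =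
    e * (K2 * `|v|) / ((K2 + 1) * (`|v| + 1)) by ring.
  by rewrite ler_pdivrMr// ler_wpM2l ?(ltW e0)// ler_pM ?K2_ge0// lerDl.
have [xi xiP] := choice lim.
have xiG v : gclosure Gam (xi v) (DN (v, xi v)).
  move=> e e0.
  have k1 : 0 < `|v| + 1 + c by rewrite ltr_wpDr// ltr_wpDl.
  have e1 : 0 < e / (`|v| + 1 + c) by rewrite divr_gt0.
  (* The closure asks for two estimates: [w n v] within [e] of the limit, and [h] within [e] of
     [DN (v, xi v)]; the second costs c + |v| times the smaller bound. *)
  have e1' : 0 < Num.min e (e / (`|v| + 1 + c)) by rewrite lt_min e0.
  have [d d0 Hd] := qe _ e1.
  have [M HM] := small v d d0; have [M' HM'] := xiP v _ e1'.
  pose n := maxn M M'.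
  have := HM' n (leq_maxr _ _); rewrite le_min => /andP[h1 h2].
  have [h [wh hD]] := Hd v (s n) (s0 n) (HM n (leq_maxl _ _)).
  exists (w n v), h; split => //; first by rewrite distrC.
  rewrite -(subrKA (DN (v, w n v))) (le_trans (ler_normD _ _))//.
  have -> : DN (v, xi v) - DN (v, w n v) = DN (0, xi v - w n v).
    rewrite -linearB; congr (DN _).
    by rewrite -[LHS]/(v - v, xi v - w n v) subrr.
  rewrite [`|DN (v, w n v) - h|]distrC (le_trans (lerD (DN_le _) hD))//.
  rewrite distrC (le_trans (lerD (ler_wpM2l c0 h2) (lexx _)))//.
  have -> : c * (e / (`|v| + 1 + c)) + e / (`|v| + 1 + c) * `|v| =
    e * ((c + `|v|) / (`|v| + 1 + c)) by ring.
  rewrite ler_piMr ?(ltW e0)// ler_pdivrMr// mul1r; lra.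
have uniq v u : gclosure Gam u (DN (v, u)) -> u = xi v.
  move=> uG; apply/subr0_eq/eqP; rewrite -normr_le0.
  have := @approx_solutions_close v _ _ _ _ 0 uG (xiG v).
  by rewrite mulr0 !subrr normr0; apply.
have xilin : bounded_lin xi.
  split.
    move=> a v u; apply/esym/uniq.
    have := gclosure_linear GL a (xiG v) (xiG u); congr (gclosure _ _ _).
    by rewrite -linearZ -linearD.
  exists (kap * `|DN| / q) => v.
  have := contraction_bound (gclosure_bounded kap0 GB (xiG v)) (a := `|DN| * `|v|).
  rewrite mulrA [kap * `|DN| / q * _]mulrAC; apply.
  rewrite DN_pair addrC (le_trans (ler_normD _ _))// lerD ?DN_le//.
  rewrite (le_trans (ler_blin _ _))// ler_wpM2l//.
  by rewrite prod_normE/= normr0 max_l.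
exists (mkblin xi); split; last by move=> v; rewrite mkblinE.
move=> e e0.
have k1 : 0 < K2 + 1 by rewrite ltr_wpDl// K2_ge0.
have [d d0 Hd] := qe _ (divr_gt0 e0 k1).
near=> v; rewrite mkblinE//.
(* Step size 1 suffices, because the quotient is then [dz v] itself and its distance to [xi v] is
   the remainder to be estimated. *)
have vd : `|1 *: v| < d.
  rewrite scale1r; near: v.
  have /cvgr_norm_lt := @cvg_id _ (nbhs (0 : Lam)); rewrite normr0; exact.
have [h [wh hD]] := Hd v 1 ltr01 vd.
have := @approx_solutions_close v _ _ _ _ (e / (K2 + 1) * `|v|) (gclosure_sub wh) (xiG v) hD.
rewrite subrr normr0 invr1 !scale1r => /(_ _)/le_trans; apply.
  by rewrite mulr_ge0// divr_ge0// ltW.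
rewrite mulrA ler_wpM2r// mulrCA ler_piMr ?(ltW e0)// ler_pdivrMr// mul1r.
by rewrite lerDl.
Unshelve. all: by end_near. Qed.

End GraphImplicit.

Section GraphImplicitClass.
Context {R : realType}.

(** The space, the graph and [N] are quantified inside the induction, as the derivative solves its
    equation in operators from [Lam] to [B]. The constants [kap] and [c] pass unchanged to it. *)
Lemma class_C_graph_solution (Lam : normedModType R) (Sigma : set Lam) (kap c : R) n :
  open Sigma -> 0 <= kap -> 0 <= c -> kap * c < 1 ->
  forall (B : normedModType R) (Gam : B -> B -> Prop) (N : Lam * B -> B) (z : Lam -> B),
  seq_complete B -> graph_linear Gam -> graph_bounded Gam kap ->
  (forall l u v, Sigma l -> `|N (l, u) - N (l, v)| <= c * `|u - v|) ->
  (forall l, Sigma l -> Gam (z l) (N (l, z l))) ->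
  class_C n (Sigma `*` setT) N -> class_C n Sigma z.
Proof.
move=> oS kap0 c0 kc; elim: n => [|n IH] B Gam N z Bc GL GB NLip zN NC.
  by apply: (graph_solution_continuous oS kap0 kc GL GB NLip zN) => l u Sl; exact: NC.
have Nc := class_C_continuous NC.
have zc l : Sigma l -> {for l, continuous z}.
  move=> Sl; apply: (graph_solution_continuous oS kap0 kc GL GB NLip zN) => // m u Sm.
  exact: Nc.
(* A first use of the induction hypothesis, for [z] itself: the coefficient [DN (l, z l)] of the
   derived equation must be of class C^n before the second use, for [frechet z]. *)
have zC := IH B Gam N z Bc GL GB NLip zN (class_CW NC).
case: NC => Nd NC.
pose DN p := frechet N p.
have ND l u : Sigma l -> has_frechet N (l, u) (DN (l, u)).
  by move=> Sl; apply/has_frechetP; split=> //; exact: Nd.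
have xiP l : Sigma l -> differentiable z l /\
    forall v, gclosure Gam (frechet z l v) (DN (l, z l) (v, frechet z l v)).
  move=> Sl.
  have [L [/has_frechetP[zd ->] LG]] :=
    graph_solution_frechet oS Bc kap0 c0 kc GL GB NLip zN Sl (ND l (z l) Sl) (zc l Sl).
  by split.
split; first by move=> l /xiP[].
(* Taken vector by vector, so that linearity and the bound [kap] carry over to the operator norm. *)
pose Gam' (U V : blin Lam B) := forall v, gclosure Gam (U v) (V v).
pose M (U : blin Lam B) : blin Lam (Lam * B)%type :=
  blin_inl Lam B + blin_comp (blin_inr Lam B) U.
pose N' (p : Lam * blin Lam B) : blin Lam B := blin_comp (DN (p.1, z p.1)) (M p.2).
have N'E l U v : N' (l, U) v = DN (l, z l) (v, U v).
  by rewrite -[LHS]/(DN (l, z l) (blin_inl Lam B v + blin_inr Lam B (U v))) blin_pairE.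
apply: (IH (blin Lam B) Gam' N' (frechet z)).
- exact: blin_seq_complete.
- by move=> a U V U' V' UV UV' v; exact: (gclosure_linear GL a (UV v) (UV' v)).
- move=> U V UV; apply: blin_norm_le => [|v]; first by rewrite mulr_ge0.
  apply: le_trans (gclosure_bounded kap0 GB (UV v)) _.
  by rewrite -mulrA ler_wpM2l// ler_blin.
- move=> l U V Sl; apply: blin_norm_le => [|v]; first by rewrite mulr_ge0.
  rewrite blinBE !N'E -linearB.
  have -> : (v, U v) - (v, V v) = (0, (U - V) v) by rewrite -[LHS]/(v - v, U v - V v) subrr.
  rewrite (le_trans (partial_lipschitz (fun u v => NLip l u v Sl) (ND l (z l) Sl) _))//.
  by rewrite -mulrA ler_wpM2l// ler_blin.
- by move=> l Sl v; rewrite N'E; exact: (xiP l Sl).2.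
have oT : open (Sigma `*` setT : set (Lam * blin Lam B)%type) by exact: open_setXT.
apply: (class_C_bilin oT (@blin_comp_bilin _ _ _ _)).
  apply: (class_C_comp (V := Sigma `*` setT) (u := fun p => (p.1, z p.1)) (phi := frechet N) oT) => //.
  pose i1 := blin_comp (blin_inl Lam B) (blin_fst Lam (blin Lam B)).
  apply: (@class_C_eq _ _ _ n _ (fun p => i1 p + blin_inr Lam B (z (blin_fst Lam (blin Lam B) p)))) => //.
    by move=> p _; rewrite /i1/= blin_fstE blin_pairE.
  apply: class_CD => //; first exact: class_C_lin.
  apply: class_C_post => //.
  apply: (class_C_comp (V := Sigma) (u := blin_fst Lam (blin Lam B)) (phi := z) oT) => //.
    by move=> p [Sp _]; rewrite blin_fstE.
  exact: class_C_lin.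
apply: class_CD => //; first exact: class_C_cst.
apply: (class_C_bilin oT (@blin_comp_bilin _ _ _ _)); first exact: class_C_cst.
apply: (@class_C_eq _ _ _ n _ (blin_snd Lam (blin Lam B))) => //.
  by move=> p _; rewrite blin_sndE.
exact: class_C_lin.
Qed.

End GraphImplicitClass.

(** * The a priori bound from the dichotomy *)

Section Dichotomy.
Context {R : realType} {X : normedModType R}.

Lemma blin_linearB (E F : normedModType R) (f : blin E F) x y :
  f (x - y) = f x - f y.
Proof. exact: linearB. Qed.

(** The map s -> [T t s (Q s (z s))] ends at [Q t (z t)], vanishes in the distant past as z is
    bounded, and has slope at most D H exp(-rho (t - s)), with integral D H / rho. Decay is assumed
    for r < t only, so that both branches of [green] fit, the unstable one after time reversal. *)
Lemma dichotomy_half (T : R -> R -> blin X X) (Q : R -> blin X X) (D rho Z H t : R)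
    (z : R -> X) :
  0 < D -> 0 < rho -> 0 <= H ->
  (forall t s r v, T t s (T s r v) = T t r v) ->
  (forall v, T t t v = v) ->
  (forall t s v, T t s (Q s v) = Q t (T t s v)) ->
  (forall r v, r < t -> `|T t r (Q r v)| <= D * expR (- rho * (t - r)) * `|v|) ->
  (forall s, `|z s| <= Z) ->
  (forall s e, 0 < e -> \forall r \near s, `|z r - T r s (z s)| <= (H + e) * `|r - s|) ->
  `|Q t (z t)| <= D / rho * H.
Proof.
move=> D0 rho0 H0 cocycle Tid TQ Tdec zZ zH.
pose phi s := T t s (Q s (z s)).
pose E s := expR (- rho * (t - s)).
have E1 s : s <= t -> E s <= 1.
  by move=> st; rewrite /E -expR0 ler_expR mulNr oppr_le0 mulr_ge0 ?(ltW rho0)// subr_ge0.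
(* By invariance and the cocycle law an increment of [phi] is the propagated defect of [z], so no
   increment of [Q] has to be estimated. *)
have phiB r s : phi r - phi s = T t r (Q r (z r - T r s (z s))).
  have -> : Q r (z r - T r s (z s)) = Q r (z r) - T r s (Q s (z s)).
    by rewrite blin_linearB TQ.
  by rewrite blin_linearB cocycle.
have dE (s : R) : is_derive s 1 E (rho * E s).
  have dg : is_derive s 1 (fun s : R => - rho * (t - s)) rho.
    have -> : (fun s : R => - rho * (t - s)) = (rho *: @idfun R) + cst (- rho * t).
      apply/funext => u; rewrite -[RHS]/(rho * u + (- rho * t)); ring.
    by apply: is_derive_eq; rewrite addr0 -[RHS]mulr1.
  by have := is_derive1_comp (is_derive_expR _) dg; rewrite mulrC.
have step s : s < t -> `|phi t - phi s| <= D / rho * H.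
  move=> st.
  have -> : D / rho * H = (D / rho * H) * E t.
    by rewrite /E subrr mulr0 expR0 mulr1.
  apply: (le_trans (mean_value_le (B := fun s => D / rho * H * E s) (b := fun s => D * H * E s) (ltW st) _ _ _)).
  - by move=> r _ _; rewrite !mulr_ge0 ?expR_ge0 ?(ltW D0).
  - move=> r _ _; have -> : D * H * E r = D / rho * H * (rho * E r).
      by field; rewrite gt_eqF.
    exact: is_deriveZ.
  - move=> r e sr rt e0.
    (* [e] is halved between the slope of the defect, multiplied by at most [D], and the variation
       of [E], multiplied by D H. *)
    have De : 0 < e / (2 * D) by rewrite divr_gt0// mulr_gt0.
    have DH : 0 < e / (2 * (D * H + 1)) by rewrite divr_gt0// mulr_gt0// ltr_wpDl// mulr_ge0// ltW.
    have Ec : {for r, continuous E}.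
      by apply/differentiable_continuous/derivable1_diffP; case: (dE r).
    have /cvgr_distC_le/(_ _ DH) Enear := Ec.
    have tnear : r < t -> \forall u \near r, u < t by move=> rt'; exact: lt_nbhsl.
    have Hnear := zH r _ De.
    (* Conditional on r < t; at r = t the bound u < t follows instead from u <= t once u differs
       from r. *)
    have {}tnear : \forall u \near r, r < t -> u < t.
      have [rt'|rt'] := ltP r t; last by near=> u.
      by apply: filterS (tnear rt').
    near=> u => su ut.
    have [->|ur] := eqVneq u r.
      by rewrite !subrr !normr0 mulr0.
    have utt : u < t.
      have [rt'|tr] := ltP r t; first by move: rt'; near: u.
      rewrite lt_neqAle ut andbT; apply: contra ur => /eqP ->.
      by rewrite eq_le rt tr.
    rewrite phiB (le_trans (Tdec _ _ utt))// -/(E u).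
    have h1 : `|z u - T u r (z r)| <= (H + e / (2 * D)) * `|u - r| by near: u.
    have h2 : `|E u - E r| <= e / (2 * (D * H + 1)) by near: u.
    apply: le_trans (_ : D * E u * ((H + e / (2 * D)) * `|u - r|) <= _).
      by rewrite ler_wpM2l// mulr_ge0 ?expR_ge0 ?(ltW D0).
    rewrite mulrA ler_wpM2r//.
    have -> : D * E u * (H + e / (2 * D)) = D * H * E u + e / 2 * E u.
      by field; rewrite gt_eqF.
    have : e / 2 * E u <= e / 2 by rewrite ler_piMr ?E1// divr_ge0 ?(ltW e0).
    have : D * H * E u <= D * H * E r + e / 2; last by lra.
    have : E u <= E r + e / (2 * (D * H + 1)).
      by rewrite -lerBlDl (le_trans (ler_norm _)).
    move=> /(ler_wpM2l (mulr_ge0 (ltW D0) H0))/le_trans; apply.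
    rewrite mulrDr lerD2l.
    have k1 : 0 < D * H + 1 by rewrite ltr_wpDl// mulr_ge0// ltW.
    have -> : D * H * (e / (2 * (D * H + 1))) = e / 2 * (D * H / (D * H + 1)).
      by field; rewrite gt_eqF.
    by rewrite ler_piMr ?divr_ge0 ?(ltW e0)// ler_pdivrMr// mul1r lerDl.
  by rewrite lerBlDr lerDl mulr_ge0 ?expR_ge0// mulr_ge0// divr_ge0// ltW.
have Z0 : 0 <= Z by apply: le_trans (zZ 0).
apply/ler_addgt0Pr => e e0.
have k0 : 0 < D * Z + 1 by rewrite ltr_wpDl// mulr_ge0// ltW.
(* So far in the past that D Z exp(-rho (t - s)) is at most [e], by exp(x) >= 1 + x with x = (D Z +
   1) / e. *)
pose s := t - (D * Z + 1) / (rho * e).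
have st : s < t by rewrite /s ltrBlDr ltrDl divr_gt0// mulr_gt0.
have -> : Q t (z t) = phi t by rewrite /phi Tid.
rewrite -[phi t](subrK (phi s)) (le_trans (ler_normD _ _))// lerD ?step//.
rewrite (le_trans (Tdec _ _ st))//.
have -> : - rho * (t - s) = - ((D * Z + 1) / e).
  by rewrite /s; field; rewrite !gt_eqF.
rewrite expRN -mulrA mulrCA ler_pdivrMl ?expR_gt0//.
apply: le_trans (_ : (1 + (D * Z + 1) / e) * e <= _); last first.
  by rewrite ler_wpM2r ?(ltW e0)// expR_ge1Dx.
rewrite mulrDl mul1r divfK ?gt_eqF//.
have : D * `|z s| <= D * Z by rewrite ler_wpM2l// ltW.
by move: (D * _) (D * Z) => *; lra.
Unshelve. all: by end_near. Qed.

(** A solution of the forced equation and one of the homogeneous equation through the same point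
    separate at rate [h]; this turns the equation into the slope bound of [dichotomy_half]. *)
Lemma evolution_expansion (v : R -> X) (s : R) (w h : X) (u : R -> X) (K e : R) :
  is_derive s 1 v (w + h) -> is_derive s 1 u w -> u s = v s -> `|h| <= K -> 0 < e ->
  \forall r \near s, `|v r - u r| <= (K + e) * `|r - s|.
Proof.
move=> dv du uv hK e0.
have [Bd BE] : is_derive s 1 (v - u) h.
  by have := is_deriveB dv du; rewrite addrAC subrr add0r.
have /derivable_nbhs/eqaddoP/(_ _ e0) := Bd.
rewrite [X in _ -> X](near_shift 0) subr0; apply: filterS => r /=.
rewrite -[X in `|X| <= _ -> _]/((v - u) (r *: 1 + s) - ((v - u) s + r *: 'D_1 (v - u) s)) BE.
rewrite -[(v - u) s]/(v s - u s) uv subrr add0r /GRing.scale/= mulr1 addrK => H.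
have -> : v (r + s) - u (r + s) = (v - u) (r + s) - r *: h + r *: h by rewrite subrK.
rewrite (le_trans (ler_normD _ _))// [leLHS]addrC mulrDl lerD//.
by rewrite normrZ mulrC ler_wpM2r.
Qed.

End Dichotomy.

Section DichotomyBound.
Context {R : realType} {X : completeNormedModType R}.

(** Each of the two spectral parts of z(t) is bounded by D/rho times H, and their sum is z(t). *)
Lemma dichotomy_bound (A : R -> blin X X) (T : R -> R -> blin X X) (D rho : R)
    (z h : R -> X) (Z H : R) :
  evolution_family A T -> exponential_dichotomy T D rho ->
  (forall t : R, is_derive t 1 z (A t (z t) + h t)) ->
  (forall t, `|z t| <= Z) -> (forall t, `|h t| <= H) ->
  forall t, `|z t| <= 2 * D / rho * H.
Proof.
move=> [Tsol Tuniq] [D0 rho0 [P [_ TP Tdec]]] dz zZ hH t.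
have Tid s v : T s s v = v by have [] := Tsol s v.
have cocycle a b r v : T a b (T b r v) = T a r v.
  by have [_ /Tuniq xT] := Tsol r v; exact/esym/xT.
have H0 : 0 <= H by apply: le_trans (hH 0).
have TP' a b v : T a b (P b v) = P a (T a b v).
  by have := congr1 (fun L : blin X X => L v) (TP a b).
have expand s e : 0 < e -> \forall r \near s, `|z r - T r s (z s)| <= (H + e) * `|r - s|.
  move=> e0; have [Ts dT] := Tsol s (z s).
  by apply: evolution_expansion (dz s) _ _ (hH s) e0 => //; have := dT s; rewrite Ts.
have green_le a b v : `|green T P a b v| <= D * expR (- rho * `|a - b|) * `|v|.
  by rewrite (le_trans (ler_blin _ _))// ler_wpM2r.
have stable : `|P t (z t)| <= D / rho * H.
  apply: (dichotomy_half D0 rho0 H0 cocycle (Tid t) TP' _ zZ expand).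
  move=> r v rt; have := green_le t r v; rewrite /green (ltW rt).
  by rewrite ger0_norm// subr_ge0 ltW.
have unstable : `|(blin_id X - P t) (z t)| <= D / rho * H.
  (* Time reversal turns the unstable part into a stable one: the data are read at negative times
     and Id - P replaces P. The minus sign in [green] disappears in the norm. *)
  have := @dichotomy_half R X (fun a b => T (- a) (- b)) (fun a => blin_id X - P (- a))
    D rho Z H (- t) (fun a => z (- a)) D0 rho0 H0.
  rewrite opprK; apply => //.
  - by move=> a b v; rewrite !blinBE blin_linearB TP'.
  - move=> r v rt.
    have tr : t < - r by rewrite ltrNr.
    have := green_le t (- r) v; rewrite /green.
    have -> : (- r <= t) = false by rewrite leNgt tr.
    rewrite -[(- blin_comp _ _) v]/(- (T t (- r) ((blin_id X - P (- r)) v))) normrN.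
    by rewrite ltr0_norm ?subr_lt0// opprB [- r - t]addrC.
  - move=> s e e0; have := expand (- s) e e0.
    have Nc : (fun r : R => - r) @ s --> - s by apply: cvgN; exact: cvg_id.
    move=> /Nc Hs; near=> r.
    have : `|z (- r) - T (- r) (- s) (z (- s))| <= (H + e) * `|- r - - s| by near: r.
    by rewrite opprK [- r + s]addrC [`|s - r|]distrC.
have -> : z t = P t (z t) + (blin_id X - P t) (z t).
  by rewrite blinBE subrKC.
rewrite (le_trans (ler_normD _ _))// (le_trans (lerD stable unstable))//.
by rewrite le_eqVlt; apply/orP; left; apply/eqP; ring.
Unshelve. all: by end_near. Qed.

End DichotomyBound.

(** * Symmetry and mixed partial derivatives *)

Section IteratedDerivatives.
Context {R : realType}.
Implicit Types E F G H V W : normedModType R.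

Lemma multilin_post_linear V G H n (L : blin G H) :
  linear (multilin_post (E := V) (n := n) L).
Proof.
elim: n G H L => [|n IH] G H L; first exact: blin_linear.
exact: (IH _ _ (blin_post V L)).
Qed.

Lemma blin_post_norm E F G (L : blin F G) : `|blin_post E L| <= `|L|.
Proof. by apply: blin_norm_le => // f; exact: opnorm_comp. Qed.

Lemma multilin_post_le V G H n (L : blin G H) (x : multilin V G n) :
  `|multilin_post L x| <= `|L| * `|x|.
Proof.
elim: n G H L x => [|n IH] G H L x; first exact: ler_blin.
apply: le_trans (IH _ _ (blin_post V L) x) _.
by rewrite ler_wpM2r// blin_post_norm.
Qed.

Lemma multilin_post_bounded V G H n (L : blin G H) :
  bounded_lin (multilin_post (E := V) (n := n) L).
Proof.
by split; [exact: multilin_post_linear | exists `|L| => x; exact: multilin_post_le].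
Qed.

(* [i] will be the identity or one of the injections into a product, which gives
   the full and the partial derivatives. *)
Definition dpart V E G (i : blin V E) (g : E -> G) (p : E) : blin V G :=
  blin_comp (frechet g p) i.

Fixpoint dparts V E G (i : blin V E) (n : nat) (g : E -> G) : E -> multilin V G n :=
  match n return E -> multilin V G n with
  | 0 => g
  | n'.+1 => dparts i n' (dpart i g)
  end.

(** Full derivatives are the case of the identity, so rules for [iter_frechet] become instances of
    those for [dparts]. *)
Lemma dparts_id E G n (g : E -> G) : dparts (blin_id E) n g = iter_frechet n g.
Proof.
elim: n G g => //= n IH G g; rewrite IH; congr iter_frechet.
by apply/funext => p; apply: blin_ext.
Qed.

Lemma class_C_dpart V E G n (i : blin V E) (U : set E) (g : E -> G) : open U ->
  class_C n.+1 U g -> class_C n U (dpart i g).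
Proof.
move=> oU [_ gC].
exact: (class_C_bilin oU (@blin_comp_bilin _ _ _ _) gC (@class_C_cst _ _ _ n U i)).
Qed.

Lemma class_C_dparts V E G m n (i : blin V E) (U : set E) (g : E -> G) : open U ->
  class_C (m + n) U g -> class_C m U (dparts i n g).
Proof.
move=> oU; elim: n G g => [|n IH] G g; first by rewrite addn0.
by rewrite addnS => gC; apply: IH; exact: class_C_dpart.
Qed.

Lemma dpart_eq V E G (i : blin V E) (U : set E) (f g : E -> G) p : open U ->
  (forall x, U x -> differentiable f x) -> (forall x, U x -> f x = g x) -> U p ->
  dpart i g p = dpart i f p.
Proof.
move=> oU fd fg Up; rewrite /dpart.
have [|_ ->//] := @frechet_near_eq _ _ _ f g p _ (fd p Up).
have nU : \forall y \near p, U y by exact: open_nbhs_nbhs.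
by apply: filterS nU.
Qed.

Lemma dparts_eq V E G n (i : blin V E) (U : set E) (f g : E -> G) p : open U ->
  class_C n U f -> (forall x, U x -> f x = g x) -> U p ->
  dparts i n g p = dparts i n f p.
Proof.
move=> oU; elim: n G f g => [|n IH] G f g fC fg Up /=; first by rewrite fg.
apply: (IH _ (dpart i f) (dpart i g)); [exact: class_C_dpart| |exact: Up].
by case: fC => fd _ x Ux; rewrite (dpart_eq _ oU fd fg Ux).
Qed.

Lemma dpart_post V E G H (i : blin V E) (L : blin G H) (g : E -> G) p :
  differentiable g p -> dpart i (fun x => L (g x)) p = blin_post V L (dpart i g p).
Proof.
move=> gd; rewrite /dpart.
have [_ ->] : differentiable (fun x => L (g x)) p /\
    frechet (fun x => L (g x)) p = blin_comp L (frechet g p).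
  apply/has_frechetP; apply: has_frechet_comp; last exact: has_frechet_blin.
  exact/has_frechetP.
exact: blin_ext.
Qed.

Lemma dparts_post V E G H n (i : blin V E) (U : set E) (L : blin G H) (g : E -> G) p :
  open U -> class_C n U g -> U p ->
  dparts i n (fun x => L (g x)) p = multilin_post L (dparts i n g p).
Proof.
move=> oU; elim: n G H L g => [//|n IH] G H L g gC Up /=.
rewrite -(IH _ _ (blin_post V L) (dpart i g))//; last exact: class_C_dpart.
apply: (@dparts_eq _ _ _ n i U _ _ p oU _ _ Up).
  by apply: class_C_post => //; exact: class_C_dpart.
by case: gC => gd _ x Ux; rewrite dpart_post//; exact: gd.
Qed.

Lemma dpartsD V E G n (i : blin V E) (U : set E) (f g : E -> G) p :
  open U -> class_C n U f -> class_C n U g -> U p ->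
  dparts i n (fun x => f x + g x) p = dparts i n f p + dparts i n g p.
Proof.
move=> oU; elim: n G f g => [//|n IH] G f g fC gC Up /=.
rewrite -IH//; try exact: class_C_dpart.
apply: (@dparts_eq _ _ _ n i U _ _ p oU _ _ Up).
  by apply: class_CD => //; exact: class_C_dpart.
case: fC gC => fd _ [gd _] x Ux; rewrite /dpart.
have [_ ->] : differentiable (fun x => f x + g x) x /\
    frechet (fun x => f x + g x) x = frechet f x + frechet g x.
  apply/has_frechetP; apply: has_frechetD; apply/has_frechetP.
    by split=> //; exact: fd.
  by split=> //; exact: gd.
exact: blin_ext.
Qed.

(** Freezing a variable means restricting to an affine slice; this links [mixed_partial], defined by
    freezing, with [dparts], defined on the product. *)
Lemma iter_frechet_affine V E G n (i : blin V E) (U : set E) (g : E -> G) (q : E) v :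
  open U -> class_C n U g -> U (q + i v) ->
  iter_frechet n (fun w => g (q + i w)) v = dparts i n g (q + i v).
Proof.
move=> oU; elim: n G g v => [//|n IH] G g v gC Uv /=.
have iq w : differentiable (fun w => q + i w) w /\ frechet (fun w => q + i w) w = i.
  apply/has_frechetP; rewrite -[X in has_frechet _ _ X]add0r.
  by apply: has_frechetD; [exact: has_frechet_cst | exact: has_frechet_blin].
have oV : open [set w | U (q + i w)].
  apply: (@open_comp _ _ (fun w => q + i w)) => // w _.
  by case: (iq w) => /differentiable_continuous.
rewrite -IH//; last exact: class_C_dpart.
rewrite -!dparts_id; apply: (@dparts_eq _ _ _ n _ [set w | U (q + i w)] _ _ v oV _ _ Uv).
  apply: (class_C_comp (V := U) (phi := dpart i g)) => //; last exact: class_C_dpart.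
  by apply: class_CD => //; [exact: class_C_cst | exact: class_C_lin].
move=> w Uw; rewrite /dpart; apply/esym.
suff [_ ->] : differentiable (fun w => g (q + i w)) w /\
  frechet (fun w => g (q + i w)) w = blin_comp (frechet g (q + i w)) i by [].
apply/has_frechetP; apply: (has_frechet_comp (f := fun w => q + i w) (g := g)).
  exact/has_frechetP.
by apply/has_frechetP; split=> //; case: gC => + _; apply.
Qed.

(** The mean value inequality for u -> g(u + b) - g(u) - H b u between x and x + a; its derivative
    there is small because [frechet g] is differentiable at x. *)
Lemma second_difference E G (U : set E) (g : E -> G) x (H : blin E (blin E G)) (e : R) :
  open U -> U x -> (forall y, U y -> differentiable g y) ->
  has_frechet (frechet g) x H -> 0 < e ->
  exists2 d, 0 < d & forall a b, `|a| + `|b| < d ->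
    `|g (x + a + b) - g (x + a) - (g (x + b) - g x) - H b a|
      <= e * (`|a| + `|b|) * `|a|.
Proof.
move=> oU Ux gd gH e0.
have e20 : 0 < e / 2 by rewrite divr_gt0.
have nU : \forall h \near (0 : E), U (x + h).
  by apply: near_addr0; exact: open_nbhs_nbhs.
have : \forall h \near (0 : E), U (x + h) /\
    `|frechet g (x + h) - frechet g x - H h| <= e / 2 * `|h|.
  by apply: filterI => //; exact: gH.
move=> /nbhs_ballP[d d0 Hd]; exists d => // a b abd.
have {}Hd h : `|h| <= `|a| + `|b| -> U (x + h) /\
    `|frechet g (x + h) - frechet g x - H h| <= e / 2 * (`|a| + `|b|).
  move=> hab; have [|Uh hb] := Hd h.
    by rewrite -ball_normE /ball_/= sub0r normrN (le_lt_trans hab).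
  by split=> //; rewrite (le_trans hb)// ler_wpM2l// ltW.
pose psi u := g (u + b) + (- blin_id G) (g u) + (- H b) u.
have sa (s : R) : 0 <= s -> s <= 1 -> `|s *: a| <= `|a|.
  by move=> s0 s1; rewrite normrZ ger0_norm// ler_piMl.
have dpsi s : 0 <= s -> s <= 1 -> differentiable psi (x + s *: a) /\
    frechet psi (x + s *: a) = frechet g (x + (s *: a + b)) +
      blin_comp (- blin_id G) (frechet g (x + s *: a)) - H b.
  move=> s0 s1; apply/has_frechetP.
  have [U1 _] := Hd (s *: a + b) (le_trans (ler_normD _ _) (lerD (sa s s0 s1) (lexx _))).
  have [|U2 _] := Hd (s *: a); first by rewrite (le_trans (sa s s0 s1))// lerDl.
  apply: has_frechetD; last exact: has_frechet_blin.
  apply: has_frechetD.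
    have f1 : has_frechet (fun u => u + b) (x + s *: a) (blin_id E).
      rewrite -[blin_id E]addr0.
      apply: (has_frechetD (f := blin_id E) (g := cst b)); first exact: has_frechet_blin.
      exact: has_frechet_cst.
    have g1 : has_frechet g (x + s *: a + b) (frechet g (x + (s *: a + b))).
      by rewrite addrA in U1 *; apply/has_frechetP; split=> //; exact: gd.
    have := has_frechet_comp f1 g1.
    by rewrite (_ : blin_comp _ (blin_id E) = frechet g (x + (s *: a + b)))//; exact: blin_ext.
  apply: (has_frechet_comp (f := g)); last exact: has_frechet_blin.
  by apply/has_frechetP; split=> //; exact: gd.
have -> : g (x + a + b) - g (x + a) - (g (x + b) - g x) - H b a = psi (x + a) - psi x.
  rewrite /psi -[(- blin_id G) (g (x + a))]/(- g (x + a)) -[(- blin_id G) (g x)]/(- g x).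
  rewrite -[(- H b) x]/(- H b x) -[(- H b) (x + a)]/(- H b (x + a)).
  rewrite [H b (x + a)]linearD.
  rewrite !opprD !opprK !addrA.
  by rewrite [RHS](ACl (1*2*5*6*4*3*7))/= subrK.
apply: mean_value_frechet => s s0 s1; first by case: (dpsi s s0 s1).
have [_ ->] := dpsi s s0 s1.
have [|_ h1] := Hd (s *: a + b).
  by rewrite (le_trans (ler_normD _ _))// lerD ?sa.
have [|_ h2] := Hd (s *: a); first by rewrite (le_trans (sa s s0 s1))// lerDl.
rewrite (le_trans (ler_blin _ _))// ler_wpM2r//.
have -> : frechet g (x + (s *: a + b)) +
      blin_comp (- blin_id G) (frechet g (x + s *: a)) - H b =
    (frechet g (x + (s *: a + b)) - frechet g x - H (s *: a + b)) -
    (frechet g (x + s *: a) - frechet g x - H (s *: a)).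
  have -> : blin_comp (- blin_id G) (frechet g (x + s *: a)) = - frechet g (x + s *: a).
    exact: blin_ext.
  rewrite [H (_ + _)]linearD !opprD !opprK !addrA.
  by rewrite [RHS](ACl (1*5*4*2*6*3*7))/= !subrK.
rewrite (le_trans (ler_normB _ _))// (le_trans (lerD h1 h2))//.
by rewrite -mulrDl -splitr.
Qed.

(** The second difference is symmetric in its increments. Comparing its two approximations at s a
    and s b, where all terms scale like s^2, leaves a bound by an arbitrary [e]. *)
Lemma frechet_sym E G (U : set E) (g : E -> G) x a b : open U -> U x ->
  class_C 2 U g -> frechet (frechet g) x a b = frechet (frechet g) x b a.
Proof.
move=> oU Ux [gd [gd2 _]].
have gH : has_frechet (frechet g) x (frechet (frechet g) x).
  by apply/has_frechetP; split=> //; exact: gd2.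
move: (frechet (frechet g) x) gH => H gH.
apply/subr0_eq.
apply: (@norm_le_eps _ _ _ ((`|a| + `|b|) * (`|a| + `|b|))) => e e0.
have [d d0 Hd] := second_difference oU Ux gd gH e0.
have ab1 : 0 < `|a| + `|b| + 1 by rewrite ltr_wpDl// addr_ge0.
have [s s0 sd] : exists2 s, 0 < s & s * (`|a| + `|b|) < d.
  exists (d / (`|a| + `|b| + 1)); first exact: divr_gt0.
  by rewrite mulrAC ltr_pdivrMr// ltr_pM2l// ltrDl.
have sab : `|s *: a| + `|s *: b| < d by rewrite !normrZ gtr0_norm// -mulrDr.
have h1 := Hd _ _ sab.
have h2 : `|g (x + s *: b + s *: a) - g (x + s *: b) - (g (x + s *: a) - g x) -
    H (s *: a) (s *: b)| <= e * (`|s *: a| + `|s *: b|) * `|s *: b|.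
  by rewrite [`|s *: a| + _]addrC; apply: Hd; rewrite addrC.
have : s * s * `|H a b - H b a| <= s * s * (e * ((`|a| + `|b|) * (`|a| + `|b|))).
  have -> : s * s * `|H a b - H b a| = `|H (s *: a) (s *: b) - H (s *: b) (s *: a)|.
    rewrite [H (s *: a)]linearZ [H (s *: b)]linearZ !blinZE.
    rewrite [H a (s *: b)]linearZ [H b (s *: a)]linearZ -!scalerBr !normrZ.
    by rewrite gtr0_norm// mulrA.
  have -> : H (s *: a) (s *: b) - H (s *: b) (s *: a) =
    (g (x + s *: a + s *: b) - g (x + s *: a) - (g (x + s *: b) - g x) -
      H (s *: b) (s *: a)) -
    (g (x + s *: b + s *: a) - g (x + s *: b) - (g (x + s *: a) - g x) -
    H (s *: a) (s *: b)).
    rewrite [x + s *: b + _]addrAC.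
    move: (g _) (g _) (g _) (g _) (H _ _) (H _ _) => p1 p2 p3 p4 p5 p6.
    rewrite !opprD !opprK !addrA.
    by rewrite [RHS](ACl (10*5*1*6*2*8*3*7*4*9))/= !addrK ?subrK.
  rewrite (le_trans (ler_normB _ _))// (le_trans (lerD h1 h2))// -mulrDr.
  rewrite !normrZ gtr0_norm// -mulrDr le_eqVlt; apply/orP; left; apply/eqP; ring.
by rewrite ler_pM2l// mulr_gt0.
Qed.

End IteratedDerivatives.

Section MixedPartials.
Context {R : realType}.
Implicit Types E F G : normedModType R.

Lemma blin_flip_rowP E F G (L : blin E (blin F G)) (y : F) :
  bounded_lin (fun x => L x y).
Proof.
split=> [a u v|]; first by rewrite linearP.
exists (`|L| * `|y|) => x; rewrite (le_trans (ler_blin _ _))// mulrAC ler_wpM2r//.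
exact: ler_blin.
Qed.

Lemma blin_flip_inP E F G (L : blin E (blin F G)) :
  bounded_lin (fun y => mkblin (fun x => L x y)).
Proof.
split=> [a u v|].
  apply: blin_ext => x; rewrite blinDE blinZE !mkblinE ?linearP//;
    exact: blin_flip_rowP.
exists `|L| => y; apply: blin_norm_le => [|x]; first by rewrite mulr_ge0.
rewrite mkblinE; last exact: blin_flip_rowP.
by rewrite (le_trans (ler_blin _ _))// mulrAC ler_wpM2r// ler_blin.
Qed.

Lemma blin_flip_bounded E F G :
  bounded_lin (fun L : blin E (blin F G) => mkblin (fun y => mkblin (fun x => L x y))).
Proof.
have E1 (L : blin E (blin F G)) x y : mkblin (fun y => mkblin (fun x => L x y)) y x = L x y.
  by rewrite (mkblinE (blin_flip_inP L)) (mkblinE (blin_flip_rowP L y)).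
split=> [a L M|].
  apply: blin_ext => y; apply: blin_ext => x.
  by rewrite E1 !(blinDE, blinZE) !E1.
exists 1 => L; rewrite mul1r; apply: blin_norm_le => // y.
apply: blin_norm_le => [|x]; first by rewrite mulr_ge0.
by rewrite E1 (le_trans (ler_blin _ _))// mulrAC ler_wpM2r// ler_blin.
Qed.

(** Interchange of arguments as a bounded operator: symmetry then reads as an identity of
    operator-valued maps and can be differentiated further. *)
Definition blin_flip E F G : blin (blin E (blin F G)) (blin F (blin E G)) :=
  mkblin (fun L : blin E (blin F G) => mkblin (fun y => mkblin (fun x => L x y))).

Lemma blin_flipE E F G (L : blin E (blin F G)) x y : blin_flip E F G L y x = L x y.
Proof.
rewrite /blin_flip (mkblinE (blin_flip_bounded E F G)).
by rewrite (mkblinE (blin_flip_inP L)) (mkblinE (blin_flip_rowP L y)).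
Qed.

Lemma blin_flip_norm E F G : `|blin_flip E F G| <= 1.
Proof.
apply: blin_norm_le => // L; rewrite mul1r; apply: blin_norm_le => // y.
apply: blin_norm_le => [|x]; first by rewrite mulr_ge0.
by rewrite blin_flipE (le_trans (ler_blin _ _))// mulrAC ler_wpM2r// ler_blin.
Qed.

Lemma frechet_dpart V E G (i : blin V E) (g : E -> G) p v w :
  differentiable (frechet g) p ->
  frechet (dpart i g) p v w = frechet (frechet g) p v (i w).
Proof.
move=> gd; have bb := @blin_comp_bilin R V E G.
have [_ ->] : differentiable (dpart i g) p /\ frechet (dpart i g) p =
    mkblin (fun v => blin_comp (frechet (frechet g) p v) i) +
    mkblin (fun v => blin_comp (frechet g p) ((0 : blin E (blin V E)) v)).
  apply/has_frechetP.
  apply: (has_frechet_bilin (f := frechet g) (g := fun _ => i) bb); last exact: has_frechet_cst.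
  exact/has_frechetP.
rewrite !blinDE (mkblinE (bilin_left i _ bb)) (mkblinE (bilin_right _ _ bb)).
by rewrite -[X in _ + X = _]/(frechet g p 0) linear0 addr0.
Qed.

Lemma dpart_swap V W E G (i : blin V E) (j : blin W E) (U : set E) (g : E -> G) p :
  open U -> class_C 2 U g -> U p ->
  dpart j (dpart i g) p = blin_flip V W G (dpart i (dpart j g) p).
Proof.
move=> oU gC Up; apply: blin_ext => w; apply: blin_ext => v.
have gd : differentiable (frechet g) p by case: gC => _ [gd _]; exact: gd.
rewrite blin_flipE -[LHS]/(frechet (dpart i g) p (j w) v).
rewrite -[RHS]/(frechet (dpart j g) p (i v) w) !frechet_dpart//.
exact: frechet_sym oU Up gC.
Qed.

(** The two orders of differentiation take values in different curried spaces; [Phi] permutes the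
    arguments. It is chosen before [g] and [p], so later derivatives pass through it. *)
Lemma dparts_dpart_swap V W E (i : blin V E) (j : blin W E) (U : set E) n : open U ->
  forall G, exists Phi : blin (blin V (multilin W G n)) (multilin W (blin V G) n),
  `|Phi| <= 1 /\ forall g : E -> G, class_C n.+1 U g -> forall p, U p ->
    dparts j n (dpart i g) p = Phi (dpart i (dparts j n g) p).
Proof.
move=> oU; elim: n => [|n IH] G.
  exists (blin_id _); split=> //.
  by apply: blin_norm_le => // x; rewrite mul1r.
have [Phi [Phi1 PhiE]] := IH (blin W G).
have mb := @multilin_post_bounded R W _ _ n (blin_flip V W G).
pose post : blin (multilin W (blin V (blin W G)) n) (multilin W (blin W (blin V G)) n) :=
  mkblin (multilin_post (blin_flip V W G)).
have post1 : `|post| <= 1.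
  apply: blin_norm_le => // x; rewrite (mkblinE mb).
  by rewrite (le_trans (multilin_post_le _ _))// ler_wpM2r// blin_flip_norm.
exists (blin_comp post Phi); split.
  rewrite (le_trans (opnorm_comp _ _))// -[leRHS]mulr1 ler_pM//; exact: opnorm_ge0.
move=> g gC p Up.
rewrite -[RHS]/(post (Phi (dpart i (dparts j n (dpart j g)) p))) (mkblinE mb).
have gjC : class_C n.+1 U (dpart j g) by exact: class_C_dpart.
rewrite -(PhiE _ gjC p Up) -(dparts_post j (blin_flip V W G) oU _ Up); last exact: class_C_dpart.
have gC2 : class_C 2 U g.
  by move: gC; elim: (n) => // m IHm /class_CW.
apply: (@dparts_eq _ _ _ _ n j U _ _ p oU _ _ Up).
  by apply: class_C_post => //; exact: class_C_dpart.
by move=> x Ux; rewrite (dpart_swap _ _ oU gC2 Ux).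
Qed.

(** Further derivatives commute with the fixed operator [Phi], whose norm is at most 1. *)
Lemma dparts_dpart_swap_le V W E G (i : blin V E) (j : blin W E) (U : set E) m n
    (g : E -> G) p : open U -> class_C (m + n).+1 U g -> U p ->
  `|dparts i m (dparts j n (dpart i g)) p| <= `|dparts i m.+1 (dparts j n g) p|.
Proof.
move=> oU gC Up.
have [Phi [Phi1 PhiE]] := dparts_dpart_swap i j n oU G.
have gC' : class_C n.+1 U g.
  by move: gC; elim: (m) => // m' IHm /class_CW.
have gC3 : class_C m U (dpart i (dparts j n g)).
  by apply: class_C_dpart => //; apply: class_C_dparts => //; rewrite addSn.
rewrite (_ : dparts i m _ p = dparts i m (fun x => Phi (dpart i (dparts j n g) x)) p).
  rewrite (dparts_post i Phi oU gC3 Up) (le_trans (multilin_post_le _ _))//.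
  by rewrite ler_piMl.
apply: (@dparts_eq _ _ _ _ m i U _ _ p oU _ _ Up); first exact: class_C_post.
by move=> x Ux; rewrite PhiE.
Qed.

Lemma blin_pre_bounded E F G (L : blin E F) : bounded_lin (fun M : blin F G => blin_comp M L).
Proof. exact: (bilin_left L (blin_id _) (@blin_comp_bilin _ _ _ _)). Qed.

Definition blin_pre E F G (L : blin E F) : blin (blin F G) (blin E G) :=
  mkblin (fun M => blin_comp M L).

Lemma blin_preE E F G (L : blin E F) (M : blin F G) : blin_pre G L M = blin_comp M L.
Proof. by rewrite /blin_pre (mkblinE (blin_pre_bounded G L)). Qed.

Lemma blin_pre_norm E F G (L : blin E F) : `|blin_pre G L| <= `|L|.
Proof. by apply: blin_norm_le => // M; rewrite blin_preE mulrC; exact: opnorm_comp. Qed.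

Lemma blin_fst_norm E F : `|blin_fst E F| <= 1.
Proof. by apply: blin_norm_le => // p; rewrite mul1r blin_fstE prod_normE le_max lexx. Qed.

Lemma blin_snd_norm E F : `|blin_snd E F| <= 1.
Proof. by apply: blin_norm_le => // p; rewrite mul1r blin_sndE prod_normE le_max lexx orbT. Qed.

Lemma blin_inr_norm E F : `|blin_inr E F| <= 1.
Proof.
apply: blin_norm_le => // p.
by rewrite mul1r blin_inrE prod_normE/= normr0 ge_max lexx normr_ge0.
Qed.

(** Each derivative splits into its parts in the two variables, which doubles the number of terms at
    every order. A derivative in the second variable only raises [j]; one in the first is moved past
    the [j] others by the swap, to reach the order of [mixed_partial]. *)
Lemma iter_frechet_mixed_le E F G (S : set E) n (C : R) (g : E * F -> G) : open S ->
  class_C n (S `*` setT) g ->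
  (forall j p, (j <= n)%N -> S p.1 ->
    `|dparts (blin_inl E F) (n - j) (dparts (blin_inr E F) j g) p| <= C) ->
  forall p, S p.1 -> `|iter_frechet n g p| <= 2 ^+ n * C.
Proof.
move=> oS; have oU : open (S `*` setT : set (E * F)%type) by exact: open_setXT.
elim: n G g => [|n IH] G g gC gB p Sp.
  by rewrite expr0 mul1r; have := gB 0 p (leqnn _) Sp.
have Up : (S `*` setT : set (E * F)%type) p by split.
pose g1 := dpart (blin_inl E F) g; pose g2 := dpart (blin_inr E F) g.
have g1C : class_C n (S `*` setT) g1 by exact: class_C_dpart.
have g2C : class_C n (S `*` setT) g2 by exact: class_C_dpart.
have B1 : `|iter_frechet n g1 p| <= 2 ^+ n * C.
  apply: IH => // j q jn Sq.
  rewrite (le_trans (dparts_dpart_swap_le _ _ oU _ _))//; first by rewrite subnK.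
  by rewrite -subSn//; apply: gB => //; exact: leqW.
have B2 : `|iter_frechet n g2 p| <= 2 ^+ n * C.
  apply: IH => // j q jn Sq.
  by have := gB j.+1 q; rewrite subSS; exact.
pose P1 := blin_pre G (blin_fst E F); pose P2 := blin_pre G (blin_snd E F).
have decomp q : S q.1 -> P1 (g1 q) + P2 (g2 q) = frechet g q.
  move=> _; apply: blin_ext => -[u v]; rewrite /P1 /P2 !blin_preE blinDE.
  rewrite -[LHS]/(frechet g q (blin_inl E F (blin_fst E F (u, v))) +
                  frechet g q (blin_inr E F (blin_snd E F (u, v)))).
  by rewrite -linearD blin_fstE blin_sndE blin_pairE.
rewrite -[iter_frechet _ _ _]/(iter_frechet n (frechet g) p) -dparts_id.
rewrite (@dparts_eq _ _ _ _ n _ (S `*` setT) (fun q => P1 (g1 q) + P2 (g2 q)) _ p oU _ _ Up).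
- rewrite (@dpartsD _ _ _ _ n _ (S `*` setT) (fun q => P1 (g1 q)) (fun q => P2 (g2 q)) p oU _ _ Up).
  + rewrite (dparts_post (blin_id _) P1 oU g1C Up) (dparts_post (blin_id _) P2 oU g2C Up) !dparts_id.
    rewrite (le_trans (ler_normD _ _))// exprS mulrDl mulrDl !mul1r lerD//.
      rewrite (le_trans (multilin_post_le _ _))// (le_trans _ B1)// ler_piMl//.
      by rewrite (le_trans (blin_pre_norm _ _))// blin_fst_norm.
    rewrite (le_trans (multilin_post_le _ _))// (le_trans _ B2)// ler_piMl//.
    by rewrite (le_trans (blin_pre_norm _ _))// blin_snd_norm.
  + exact: class_C_post.
  + exact: class_C_post.
- by apply: class_CD => //; exact: class_C_post.
- by move=> q [Sq _]; exact: decomp.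
Qed.

Lemma mixed_partialE E F G (S : set E) m n (f : E -> F -> G) l x : open S ->
  class_C (m + n) (S `*` setT) (fun p : E * F => f p.1 p.2) -> S l ->
  mixed_partial m n f l x =
  dparts (blin_inl E F) m (dparts (blin_inr E F) n (fun p => f p.1 p.2)) (l, x).
Proof.
move=> oS fC Sl; rewrite /mixed_partial.
have oU : open (S `*` setT : set (E * F)%type) by exact: open_setXT.
set g := fun p : E * F => f p.1 p.2.
have inlE l' : (0, x) + blin_inl E F l' = (l', x).
  by rewrite blin_inlE -[LHS]/(0 + l', x + 0) add0r addr0.
have inrE l' x' : (l', 0) + blin_inr E F x' = (l', x').
  by rewrite blin_inrE -[LHS]/(l' + 0, 0 + x') add0r addr0.
have gC : class_C n (S `*` setT) g.
  by move: fC; elim: (m) => // m' IHm /class_CW.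
have inner l' : S l' -> iter_frechet n (f l') x = dparts (blin_inr E F) n g (l', x).
  move=> Sl'; rewrite -(inrE l' x) -(iter_frechet_affine oU gC); last by rewrite inrE.
  by congr iter_frechet; apply/funext => w; rewrite /g inrE.
have dC : class_C m (S `*` setT) (dparts (blin_inr E F) n g) by exact: class_C_dparts.
rewrite -(inlE l) -(iter_frechet_affine oU dC); last by rewrite inlE.
rewrite -!dparts_id; apply: (@dparts_eq _ _ _ _ m _ S _ _ l oS _ _ Sl).
  apply: (class_C_comp (V := S `*` setT) oS _ _ dC) => [w Sw|].
    by rewrite inlE.
  by apply: class_CD => //; [exact: class_C_cst | exact: class_C_lin].
by move=> w Sw; rewrite inlE inner.
Qed.

End MixedPartials.

(** * Regularity of the superposition operator *)

Section UniformCriteria.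
Context {R : realType}.
Implicit Types (E F G : normedModType R) (I : Type).

(** Passes from bounds on iterated derivatives, as the hypotheses give them, to the recursive form;
    an iterate of [frechet (g t)] is the next iterate of [g t]. *)
Lemma unif_C_iter I E F n (U : set E) (g : I -> E -> F) :
  (forall t, class_C n U (g t)) ->
  (forall e0, U e0 -> exists M, \forall e \near e0, forall i t, (i <= n)%N ->
    `|iter_frechet i (g t) e| <= M) ->
  unif_C n U g.
Proof.
elim: n F g => [|n IH] F g gC gB; (split; [move=> e0 Ue; have [M gM] := gB e0 Ue;
  exists M; apply: filterS gM => e He t; exact: (He 0%N t (leq0n _))|]).
  exact: gC.
split; first by move=> t; case: (gC t).
apply: IH => [t|e0 Ue]; first by case: (gC t).
have [M gM] := gB e0 Ue; exists M; apply: filterS gM => e He i t le_in.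
exact: (He i.+1 t).
Qed.

Lemma bounded_along_iter I E F G n (U : set E) (V : set F) (u : I -> E -> F)
    (phi : I -> F -> G) (M : R) : open U -> (forall t x, U x -> V (u t x)) ->
  (forall i t p, (i <= n)%N -> V p -> `|iter_frechet i (phi t) p| <= M) ->
  bounded_along n U u phi.
Proof.
move=> oU uV; elim: n G phi => [|n IH] G phi phiM; (split; [move=> e Ue; exists M;
  have nU : \forall y \near e, U y by [exact: open_nbhs_nbhs];
  apply: filterS nU => y Uy t; exact: (phiM 0%N t _ (leq0n _) (uV t y Uy))|]) => //.
by apply: IH => i t p le_in Vp; exact: (phiM i.+1).
Qed.

Lemma unif_C_fst I E F G n (S : set E) (g : I -> E -> G) : open S ->
  unif_C n S g -> unif_C n (S `*` setT : set (E * F)%type) (fun t p => g t p.1).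
Proof.
move=> oS gC; have oU : open (S `*` setT : set (E * F)%type) by exact: open_setXT.
have fstC : unif_C n (S `*` setT : set (E * F)%type) (fun (_ : I) p => blin_fst E F p).
  exact: (@unif_C_lin _ I _ _ n _ (fun _ => blin_fst E F) _ (fun _ => lexx _)).
have bd : bounded_along n (S `*` setT : set (E * F)%type) (fun _ p => blin_fst E F p) g.
  elim: n {fstC} G g gC => [|n IH] G g [gb gC]; split => //.
  - move=> p [Sp _]; have [M gM] := gb p.1 Sp; exists M.
    have fc : (blin_fst E F) @ p --> p.1.
      by rewrite -(blin_fstE p); exact: blin_continuous.
    exact: fc _ gM.
  - move=> p [Sp _]; have [M gM] := gb p.1 Sp; exists M.
    have fc : (blin_fst E F) @ p --> p.1.
      by rewrite -(blin_fstE p); exact: blin_continuous.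
    exact: fc _ gM.
  - by apply: IH; case: gC.
apply: (unif_C_eq (g := fun t p => g t (blin_fst E F p))) => //.
  by move=> t p _; rewrite blin_fstE.
apply: (unif_C_comp (V := S) (u := fun _ p => blin_fst E F p) (phi := g) oU _ _ bd).
- by move=> _ p [Sp _]; rewrite blin_fstE.
- by move=> t; exact: unif_C_class.
- by move/unif_CE: fstC => [].
Qed.

(** A sum rule for families that may be unbounded in the index, such as y_l(t). *)
Lemma unif_dCD I E F n (U : set E) (f g : I -> E -> F) : open U ->
  unif_dC n.+1 U f -> unif_dC n.+1 U g -> unif_dC n.+1 U (fun t x => f t x + g t x).
Proof.
move=> oU [fd fC] [gd gC].
have d t x : U x -> differentiable (fun x => f t x + g t x) x /\
    frechet (fun x => f t x + g t x) x = frechet (f t) x + frechet (g t) x.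
  move=> Ux; apply/has_frechetP; apply: has_frechetD; apply/has_frechetP.
    by split=> //; exact: fd.
  by split=> //; exact: gd.
split; first by move=> t x /(d t)[].
by apply: unif_C_eq (unif_CD oU fC gC) => // t x /(d t)[_ /esym].
Qed.

Lemma unif_dC_post I E F G n (U : set E) (L : blin F G) (f : I -> E -> F) : open U ->
  unif_dC n.+1 U f -> unif_dC n.+1 U (fun t x => L (f t x)).
Proof.
move=> oU [fd fC].
have d t x : U x -> differentiable (fun x => L (f t x)) x /\
    frechet (fun x => L (f t x)) x = blin_comp L (frechet (f t) x).
  move=> Ux; apply/has_frechetP; apply: has_frechet_comp; last exact: has_frechet_blin.
  by apply/has_frechetP; split=> //; exact: fd.
split; first by move=> t x /(d t)[].
apply: (@unif_C_eq _ _ _ _ n U (fun t x => blin_comp L (frechet (f t) x))) => //.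
  by move=> t x /(d t)[_ /esym].
exact: (unif_C_bilin oU (@blin_comp_bilin _ _ _ _) (@unif_C_cst _ I _ _ n U (fun _ => L) _ (fun _ => lexx _)) fC).
Qed.

Lemma unif_dC_fst I E F G n (S : set E) (g : I -> E -> G) : open S ->
  unif_dC n.+1 S g ->
  unif_dC n.+1 (S `*` setT : set (E * F)%type) (fun t p => g t p.1).
Proof.
move=> oS [gd gC]; have oU : open (S `*` setT : set (E * F)%type) by exact: open_setXT.
have d t p : (S `*` setT : set (E * F)%type) p ->
    differentiable (fun p : E * F => g t p.1) p /\
    frechet (fun p : E * F => g t p.1) p = blin_comp (frechet (g t) p.1) (blin_fst E F).
  move=> [Sp _]; apply/has_frechetP.
  have -> : (fun p : E * F => g t p.1) = g t \o blin_fst E F.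
    by apply/funext => q /=; rewrite blin_fstE.
  apply: has_frechet_comp; first exact: has_frechet_blin.
  by rewrite blin_fstE; apply/has_frechetP; split=> //; exact: gd.
split; first by move=> t p /(d t)[].
apply: (@unif_C_eq _ _ _ _ n _ (fun t p => blin_comp (frechet (g t) p.1) (blin_fst E F))) => //.
  by move=> t p /(d t)[_ /esym].
have h1 := @unif_C_fst I E F _ n S _ oS gC.
exact: (unif_C_bilin (b := fun L M => blin_comp L M) oU (@blin_comp_bilin _ _ _ _) h1
  (@unif_C_cst _ I _ _ n _ (fun _ => blin_fst E F) _ (fun _ => lexx _))).
Qed.

Lemma class_C_le E F m n (U : set E) (f : E -> F) : (m <= n)%N ->
  class_C n U f -> class_C m U f.
Proof. by move=> /subnK<-; elim: (_ - _)%N => // d IHd /class_CW. Qed.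

Lemma iter_frechet_post E F G n (U : set E) (L : blin F G) (g : E -> F) p :
  open U -> class_C n U g -> U p ->
  iter_frechet n (fun x => L (g x)) p = multilin_post L (iter_frechet n g p).
Proof. by move=> oU gC Up; rewrite -!dparts_id (dparts_post _ L oU gC Up). Qed.

Lemma class_CB E F n (U : set E) (f g : E -> F) : open U ->
  class_C n U f -> class_C n U g -> class_C n U (fun x => f x - g x).
Proof.
move=> oU /class_C_unif fC /class_C_unif gC.
exact: (unif_C_class tt (unif_CB oU fC gC)).
Qed.

Lemma iter_frechetB E F n (U : set E) (f g : E -> F) p :
  open U -> class_C n U f -> class_C n U g -> U p ->
  iter_frechet n (fun x => f x - g x) p = iter_frechet n f p - iter_frechet n g p.
Proof.
move=> oU fC gC Up; have fgC := class_CB oU fC gC.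
apply/eqP; rewrite eq_sym subr_eq; apply/eqP.
rewrite -!dparts_id -(dpartsD _ oU fgC gC Up).
by apply/esym/(@dparts_eq _ _ _ _ n _ U _ _ p oU fC _ Up) => x _; rewrite subrK.
Qed.

End UniformCriteria.

Section NemytskiiDifference.
Context {R : realType}.
Implicit Types (E X B G : normedModType R) (I : Type).

(* The first derivatives of [F t] need not be bounded: only those in the
   direction of the second variable are, so that the difference of the two
   compositions is controlled by the mean value inequality. *)
Lemma unif_C_difference I E X B G (S : set E) (F : I -> E * X -> G)
    (Y : I -> E -> X) (ev : I -> blin B X) (c M : R) k : open S -> (0 < k)%N ->
  (forall t, class_C k.+1 (S `*` setT) (F t)) ->
  (forall t l u v, S l -> `|F t (l, u) - F t (l, v)| <= c * `|u - v|) ->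
  (forall i t p, (2 <= i <= k.+1)%N -> (S `*` setT) p -> `|iter_frechet i (F t) p| <= M) ->
  unif_dC k.+1 S Y -> (forall t, `|ev t| <= 1) ->
  unif_C k.+1 (S `*` setT : set (E * B)%type)
    (fun t p => F t (p.1, Y t p.1 + ev t p.2) - F t (p.1, Y t p.1)).
Proof.
(* From here [k] is one less than in the statement: [F t] is of class C^(k + 2), so its second
   derivative is of class C^k. *)
move=> oS; case: k => // k _ FC FL FM YC ev1.
have oU : open (S `*` setT : set (E * X)%type) by exact: open_setXT.
have oV : open (S `*` setT : set (E * B)%type) by exact: open_setXT.
pose V : set (E * B)%type := S `*` setT.
(* The increment [u1 - u0] is linear, of norm at most 1, and points in the second variable. *)
pose L t : blin (E * B)%type (E * X)%type :=
  blin_comp (blin_inr E X) (blin_comp (ev t) (blin_snd E B)).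
have LE t p : L t p = (0, ev t p.2).
  by rewrite -[LHS]/(blin_inr E X (ev t (blin_snd E B p))) blin_sndE blin_inrE.
have L1 t : `|L t| <= 1.
  apply: blin_norm_le => // p; rewrite mul1r LE prod_normE/= normr0 max_r//.
  rewrite (le_trans (ler_blin _ _))//.
  by rewrite (le_trans (ler_wpM2r _ (ev1 t)))// mul1r prod_normE le_max lexx orbT.
pose u0 t (p : E * B) : E * X := (p.1, Y t p.1).
pose u1 t (p : E * B) : E * X := (p.1, Y t p.1 + ev t p.2).
have u0E : u0 = fun t p => blin_comp (blin_inl E X) (blin_fst E B) p + blin_inr E X (Y t p.1).
  apply/funext => t; apply/funext => p.
  by rewrite -[blin_comp _ _ _]/(blin_inl E X (blin_fst E B p)) blin_fstE blin_pairE.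
have u1E : u1 = fun t p => u0 t p + L t p.
  apply/funext => t; apply/funext => p; rewrite LE -[RHS]/(p.1 + 0, Y t p.1 + ev t p.2).
  by rewrite addr0.
have linC n (T : I -> blin (E * B)%type (E * X)%type) (K : R) :
    (forall t, `|T t| <= K) -> unif_dC n V (fun t => T t).
  by move=> TK; have /unif_CE[] := @unif_C_lin _ I _ _ n V T K TK.
have u0C : unif_dC k.+2 V u0.
  rewrite u0E.
  exact: (unif_dCD oV
    (linC k.+2 (fun _ => blin_comp (blin_inl E X) (blin_fst E B)) _ (fun _ => lexx _))
    (unif_dC_post (blin_inr E X) oV (@unif_dC_fst _ I E B _ _ _ _ oS YC))).
have u1C : unif_dC k.+2 V u1.
  by rewrite u1E; exact: (unif_dCD oV u0C (linC k.+2 L 1 L1)).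
have u0V t p : V p -> (S `*` setT) (u0 t p) by case.
have u1V t p : V p -> (S `*` setT) (u1 t p) by case.
have u1L t p : V p -> frechet (u1 t) p = frechet (u0 t) p + L t.
  move=> Vp; suff [_ ->] : differentiable (u1 t) p /\ frechet (u1 t) p = frechet (u0 t) p + L t by [].
  apply/has_frechetP; rewrite u1E; apply: has_frechetD; last exact: has_frechet_blin.
  by apply/has_frechetP; split=> //; case: u0C => + _; apply.
have Fd t p : (S `*` setT) p -> has_frechet (F t) p (frechet (F t) p).
  by move=> Up; apply/has_frechetP; split=> //; case: (FC t) => + _; apply.
have DFd t p : (S `*` setT) p -> differentiable (frechet (F t)) p.
  by move=> Up; case: (FC t) => _ [+ _]; apply.
have ud (u : I -> E * B -> E * X) t p : unif_dC k.+2 V u -> V p ->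
    has_frechet (u t) p (frechet (u t) p).
  by move=> [ud _] Vp; apply/has_frechetP; split=> //; exact: ud.
have DFC : forall u : I -> E * B -> E * X, unif_dC k.+2 V u ->
    (forall t p, V p -> (S `*` setT) (u t p)) ->
    unif_C k V (fun t p => frechet (frechet (F t)) (u t p)).
  move=> u uC uV.
  apply: (@unif_C_comp _ I _ _ _ k V (S `*` setT) u (fun t => frechet (frechet (F t)))) => //.
  - by move=> t; case: (FC t) => _ [_].
  - apply: (@bounded_along_iter _ I _ _ _ k V (S `*` setT) u _ M) => // i t p ik Up.
    exact: (FM i.+2 t p).
  - exact: unif_dCW (unif_dCW uC).
(* Each term alone may be unbounded in [t]; the difference is at most M |L t p| by the bound on
   second derivatives. *)
pose W t p := frechet (F t) (u1 t p) - frechet (F t) (u0 t p).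
have M0 (t : I) (p : E * X) : (S `*` setT) p -> 0 <= M.
  by move=> Up; exact: le_trans (normr_ge0 _) (FM 2%N t p isT Up).
have WC : unif_C k.+1 V W.
  have Wb : loc_ubounded V W.
    move=> p Vp; exists (`|M| * (`|p| + 1)).
    have nV : \forall q \near p, V q by exact: open_nbhs_nbhs.
    near=> q => t.
    have Vq : V q by near: q.
    have q1 : `|q| <= `|p| + 1 by near: q; have := near_norm_le1 p; exact.
    apply: le_trans (_ : M * `|L t q| <= _); last first.
      have Lq : `|L t q| <= `|p| + 1.
        by rewrite (le_trans (ler_blin _ _))// (le_trans _ q1)// ler_piMl.
      have Mge : 0 <= M := M0 t (u0 t q) (u0V t q Vq).
      exact: ler_pM Mge (normr_ge0 _) (ler_norm M) Lq.
    rewrite /W u1E; apply: mean_value_frechet => s s0 s1.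
      apply: DFd; rewrite LE; split=> //.
      by rewrite -[_.1]/(q.1 + s *: 0) scaler0 addr0; case: Vq.
    rewrite (le_trans (ler_blin _ _))// ler_wpM2r//.
    apply: (FM 2%N) => //.
    rewrite LE; split=> //.
    by rewrite -[_.1]/(q.1 + s *: 0) scaler0 addr0; case: Vq.
  move: (DFC u1 u1C u1V) (DFC u0 u0C u0V).
  move=> D1 D0; split; first exact: Wb.
  have d t p : V p -> differentiable (W t) p /\ frechet (W t) p =
      blin_comp (frechet (frechet (F t)) (u1 t p)) (frechet (u1 t) p) -
      blin_comp (frechet (frechet (F t)) (u0 t p)) (frechet (u0 t) p).
    move=> Vp; apply/has_frechetP.
    have c1 : has_frechet (fun p => frechet (F t) (u1 t p)) p
        (blin_comp (frechet (frechet (F t)) (u1 t p)) (frechet (u1 t) p)).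
      apply: (has_frechet_comp (f := u1 t)); first exact: ud.
      by apply/has_frechetP; split=> //; apply: DFd; exact: u1V.
    have c0 : has_frechet (fun p => frechet (F t) (u0 t p)) p
        (blin_comp (frechet (frechet (F t)) (u0 t p)) (frechet (u0 t) p)).
      apply: (has_frechet_comp (f := u0 t)); first exact: ud.
      by apply/has_frechetP; split=> //; apply: DFd; exact: u0V.
    have := has_frechetD c1 (has_frechet_comp c0 (has_frechet_blin (- blin_id _) _)).
    by rewrite (_ : blin_comp (- blin_id _) _ = - blin_comp (frechet (frechet (F t)) (u0 t p)) (frechet (u0 t) p))//; exact: blin_ext.
  split; first by move=> t p /(d t)[].
  apply: (@unif_C_eq _ _ _ _ k V (fun t p =>
      blin_comp (frechet (frechet (F t)) (u1 t p)) (frechet (u1 t) p) -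
      blin_comp (frechet (frechet (F t)) (u0 t p)) (frechet (u0 t) p))) => //.
    by move=> t p /(d t)[_ /esym].
  have uC' (u : I -> E * B -> E * X) : unif_dC k.+2 V u -> unif_C k V (fun t => frechet (u t)).
    by move=> [_] /unif_CW.
  apply: unif_CB => //.
    exact: (unif_C_bilin oV (@blin_comp_bilin _ _ _ _) D1 (uC' u1 u1C)).
  exact: (unif_C_bilin oV (@blin_comp_bilin _ _ _ _) D0 (uC' u0 u0C)).
(* The partial derivative in the second variable: bounded by [c] through the Lipschitz hypothesis,
   its own derivatives by [M], whence the bound |c| + |M| below. *)
pose DxF t p := blin_comp (frechet (F t) p) (blin_inr E X).
have DxFC t : class_C k.+1 (S `*` setT) (DxF t).
  exact: (class_C_dpart (blin_inr E X) oU (FC t)).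
have QC : unif_C k.+1 V (fun t p => DxF t (u0 t p)).
  apply: (@unif_C_comp _ I _ _ _ k.+1 V (S `*` setT) u0 DxF oV u0V DxFC _ (unif_dCW u0C)).
  apply: (@bounded_along_iter _ I _ _ _ k.+1 V (S `*` setT) u0 _ (`|c| + `|M|) oV u0V).
  move=> i t p ik Up.
  case: i ik => [|i] ik.
    apply: le_trans (_ : `|c| <= _); last by rewrite lerDl.
    apply: blin_norm_le => // v.
    rewrite -[DxF t p v]/(frechet (F t) p (blin_inr E X v)) blin_inrE.
    have Sp : S p.1 by case: Up.
    have Fp : has_frechet (F t) (p.1, p.2) (frechet (F t) p).
      by rewrite -surjective_pairing; exact: Fd.
    apply: le_trans (partial_lipschitz (fun u w => FL t p.1 u w Sp) Fp v) _.
    by rewrite ler_wpM2r// ler_norm.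
  apply: le_trans (_ : `|M| <= _); last by rewrite lerDr.
  have -> : DxF t = fun p => blin_pre G (blin_inr E X) (frechet (F t) p).
    by apply/funext => q; rewrite blin_preE.
  have FC' : class_C i.+1 (S `*` setT) (frechet (F t)).
    by apply: (class_C_le ik); case: (FC t).
  rewrite (iter_frechet_post _ oU FC' Up) (le_trans (multilin_post_le _ _))//.
  have h1 : `|iter_frechet i.+1 (frechet (F t)) p| <= M := FM i.+2 t p ik Up.
  apply: (le_trans _ (le_trans h1 (ler_norm M))).
  by rewrite ler_piMl// (le_trans (blin_pre_norm _ _))// blin_inr_norm.
split.
  move=> p Vp; exists (`|c| * (`|p| + 1)).
  have nV : \forall q \near p, V q by exact: open_nbhs_nbhs.
  near=> q => t.
  have [Sq _] : V q by near: q.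
  have q1 : `|q| <= `|p| + 1 by near: q; have := near_norm_le1 p; exact.
  rewrite (le_trans (FL t _ _ _ Sq))// [Y t _ + _]addrC addrK.
  have evq : `|ev t q.2| <= `|p| + 1.
    rewrite (le_trans (ler_blin _ _))// (le_trans (ler_wpM2r _ (ev1 t)))// mul1r.
    by rewrite (le_trans _ q1)// prod_normE le_max lexx orbT.
  by rewrite (le_trans (ler_wpM2r (normr_ge0 _) (ler_norm c)))// ler_wpM2l.
(* Regrouping DF(u1) Du1 - DF(u0) Du0 as W Du1 + DF(u0) L, where Du1 = Du0 + L, leaves only factors
   with uniform bounds. *)
have d t p : V p -> differentiable (fun p => F t (u1 t p) - F t (u0 t p)) p /\
    frechet (fun p => F t (u1 t p) - F t (u0 t p)) p =
    blin_comp (W t p) (frechet (u1 t) p) +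
    blin_comp (DxF t (u0 t p)) (blin_comp (ev t) (blin_snd E B)).
  move=> Vp; apply/has_frechetP.
  have c1 : has_frechet (fun p => F t (u1 t p)) p
      (blin_comp (frechet (F t) (u1 t p)) (frechet (u1 t) p)).
    by apply: (has_frechet_comp (f := u1 t)); [exact: ud | apply: Fd; exact: u1V].
  have c0 : has_frechet (fun p => F t (u0 t p)) p
      (blin_comp (frechet (F t) (u0 t p)) (frechet (u0 t) p)).
    by apply: (has_frechet_comp (f := u0 t)); [exact: ud | apply: Fd; exact: u0V].
  have := has_frechetD c1 (has_frechet_comp c0 (has_frechet_blin (- blin_id _) _)).
  congr has_frechet; apply: blin_ext => w.
  rewrite !blinDE.
  rewrite -[blin_comp (- blin_id _) _ w]/(- (frechet (F t) (u0 t p) (frechet (u0 t) p w))).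
  rewrite -[blin_comp (frechet (F t) (u1 t p)) _ w]/(frechet (F t) (u1 t p) (frechet (u1 t) p w)).
  rewrite -[blin_comp (W t p) _ w]/(frechet (F t) (u1 t p) (frechet (u1 t) p w) -
    frechet (F t) (u0 t p) (frechet (u1 t) p w)).
  rewrite -[blin_comp (DxF t (u0 t p)) _ w]/(frechet (F t) (u0 t p) (L t w)).
  rewrite -addrA; congr (_ + _); rewrite u1L// blinDE linearD opprD.
  by rewrite -addrA addNr addr0.
split; first by move=> t p /(d t)[].
apply: (@unif_C_eq _ _ _ _ k.+1 V (fun t p => blin_comp (W t p) (frechet (u1 t) p) +
    blin_comp (DxF t (u0 t p)) (blin_comp (ev t) (blin_snd E B))) _ oV).
  by move=> t p /(d t)[_ /esym].
apply: (unif_CD oV).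
  by case: u1C => _ u1C; exact: (unif_C_bilin oV (@blin_comp_bilin _ _ _ _) WC u1C).
have evC := @unif_C_cst _ I _ _ k.+1 V (fun t => blin_comp (ev t) (blin_snd E B)) 1.
apply: (unif_C_bilin oV (@blin_comp_bilin _ _ _ _) QC (evC _)) => t.
rewrite (le_trans (opnorm_comp _ _))// -[leRHS]mulr1 ler_pM ?opnorm_ge0//.
  exact: ev1.
exact: blin_snd_norm.
Unshelve. all: by end_near. Qed.

End NemytskiiDifference.

(** * Smooth dependence of x_l on the parameter *)

Theorem corollary2 (R : realType) (X Lam : completeNormedModType R)
    (Sigma : set Lam) (HSigma : open Sigma)
    (A : R -> blin X X) (HA : continuous A)
    (T : R -> R -> blin X X) (HT : evolution_family A T)
    (f : Lam -> R -> X -> X)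
    (Hf : forall l, Sigma l -> continuous (fun p : R * X => f l p.1 p.2))
    (D rho : R) (Hdich : exponential_dichotomy T D rho)
    (c : R) (Hc : 0 <= c)
    (HLip : forall t l x y, Sigma l -> `|f l t x - f l t y| <= c * `|x - y|)
    (Hq : 2 * c * D / rho < 1)
    (k : nat) (Hk : (0 < k)%N)
    (eps : R) (Heps : 0 < eps)
    (y : Lam -> R -> X)
    (Hyd : forall l (t : R), Sigma l -> derivable (y l) t 1)
    (Hy : forall l t, Sigma l ->
      `|derive1 (y l) t - A t (y l t) - f l t (y l t)| <= eps)
    (x : Lam -> R -> X)
    (Hx : forall l, Sigma l -> is_solution (fun t v => A t v + f l t v) (x l))
    (Hxy : forall l t, Sigma l ->
      `|x l t - y l t| <= (2 * eps * D / rho) / (1 - 2 * c * D / rho))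
    (C : R) (HC : 0 < C)
    (Hf_smooth : forall t,
      class_C k.+1 (Sigma `*` setT) (fun p : Lam * X => f p.1 t p.2))
    (Hf_bound : forall i j t l v,
      (2 <= i <= k.+1)%N -> (j <= i)%N -> Sigma l ->
      `|mixed_partial (i - j) j (fun l' => f l' t) l v| <= C)
    (Hy_smooth : forall t, class_C k.+1 Sigma (fun l => y l t))
    (Hy'_smooth : forall t, class_C k.+1 Sigma (fun l => derive1 (y l) t))
    (Hy_approx : forall i t l, (1 <= i <= k.+1)%N -> Sigma l ->
      `|iter_frechet i (fun l' => derive1 (y l') t) l
        - multilin_post (A t) (iter_frechet i (fun l' => y l' t) l)
        - iter_frechet i (fun l' => f l' t (y l' t)) l| <= C)
    (Hy_bound : forall l0, Sigma l0 -> exists M : R, 1 < M /\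
      \forall l \near l0, forall i t, (1 <= i <= k.+1)%N ->
        `|iter_frechet i (fun l' => y l' t) l| <= M) :
  forall t, class_C k Sigma (fun l => x l t).
Proof.
have [D0 rho0 _] := Hdich.
pose F t (p : Lam * X) := f p.1 t p.2.
(* The negative of the defect in the hypotheses on y_l, hence bounded by [eps] at order 0 and by [C]
   at orders 1 to k + 1. *)
pose r t l := f l t (y l t) - (derive1 (y l) t - A t (y l t)).
(* Equal to f_l(t, y_l + u) + A y_l - y_l', but grouped so that both summands are bounded in [t]. *)
pose g t (p : Lam * bfun R X) :=
  F t (p.1, y p.1 t + bfun_eval X t p.2) - F t (p.1, y p.1 t) + r t p.1.
pose N p := mkbfun (fun t => g t p).
pose z l := mkbfun (fun t => x l t - y l t).
have oU : open (Sigma `*` setT : set (Lam * X)%type) by exact: open_setXT.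
have oV : open (Sigma `*` setT : set (Lam * bfun R X)%type) by exact: open_setXT.
(* The mixed partials bound the full derivative up to a factor 2^i, replaced by the common factor
   2^(k + 1). *)
have FM i t p : (2 <= i <= k.+1)%N -> (Sigma `*` setT) p ->
    `|iter_frechet i (F t) p| <= 2 ^+ k.+1 * C.
  move=> /andP[i2 ik] [Sp _].
  have FC : class_C i (Sigma `*` setT) (F t) by exact: class_C_le ik (Hf_smooth t).
  apply: le_trans (_ : 2 ^+ i * C <= _); last first.
    by rewrite ler_wpM2r ?(ltW HC)// ler_weXn2l// ler1n.
  apply: (iter_frechet_mixed_le HSigma FC) => // j [l v] ji Sl.
  rewrite -(mixed_partialE (f := fun l v => f l t v) v HSigma _ Sl); last by rewrite subnK.
  by apply: Hf_bound => //; rewrite i2.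
(* [Hy_bound] starts at order 1, which is what [unif_dC] records. *)
have YC : unif_dC k.+1 Sigma (fun t l => y l t).
  split; first by move=> t; case: (Hy_smooth t).
  apply: unif_C_iter => [t|l0 Sl0]; first by case: (Hy_smooth t).
  have [M [_ yM]] := Hy_bound l0 Sl0; exists M; apply: filterS yM => l H i t ik.
  exact: (H i.+1 t).
have rC : unif_C k.+1 Sigma r.
  have fyC t : class_C k.+1 Sigma (fun l => f l t (y l t)).
    apply: (class_C_comp (V := Sigma `*` setT) (u := fun l => (l, y l t)) HSigma _ _ (Hf_smooth t)) => //.
    apply: (@class_C_eq _ _ _ _ _ (fun l => blin_inl Lam X l + blin_inr Lam X (y l t)) _ HSigma).
      by move=> l _; exact: blin_pairE.
    by apply: (class_CD HSigma (class_C_lin _ _ _)); exact: class_C_post.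
  have AyC t : class_C k.+1 Sigma (fun l => A t (y l t)) by exact: class_C_post.
  have lyC t := class_CB HSigma (Hy'_smooth t) (AyC t).
  apply: unif_C_iter => [t|l0 Sl0]; first exact: class_CB.
  have nS : \forall l \near l0, Sigma l by exact: open_nbhs_nbhs.
  exists (eps + C); apply: filterS nS => l Sl i t ik.
  have leC m (L : normedModType R) (h : Lam -> L) : (m <= k.+1)%N -> class_C k.+1 Sigma h -> class_C m Sigma h.
    exact: class_C_le.
  rewrite (iter_frechetB HSigma (leC _ _ _ ik (fyC t)) (leC _ _ _ ik (lyC t)) Sl).
  rewrite (iter_frechetB HSigma (leC _ _ _ ik (Hy'_smooth t)) (leC _ _ _ ik (AyC t)) Sl).
  rewrite (iter_frechet_post (A t) HSigma (leC _ _ _ ik (Hy_smooth t)) Sl) distrC.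
  case: i ik => [|i] ik.
    by rewrite (le_trans (Hy l t Sl))// lerDl ltW.
  by rewrite (le_trans (Hy_approx i.+1 t l _ Sl))// lerDr ltW.
have gC : unif_C k.+1 (Sigma `*` setT : set (Lam * bfun R X)%type) g.
  have dC := unif_C_difference (F := F) (Y := fun t l => y l t) HSigma Hk Hf_smooth
    (fun t l u v Sl => HLip t l u v Sl) FM YC (bfun_eval_norm X).
  exact: (unif_CD oV dC (@unif_C_fst _ R _ (bfun R X) _ _ _ _ HSigma rC)).
(* The passage from k + 1 to k takes place here. *)
have NC : class_C k (Sigma `*` setT : set (Lam * bfun R X)%type) N.
  exact: (class_C_nemytskii oV gC).
have NE l u t : Sigma l -> N (l, u) t = f l t (y l t + u t) + A t (y l t) - derive1 (y l) t.
  move=> Sl; have gb : loc_ubounded (Sigma `*` setT : set (Lam * bfun R X)%type) g.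
    by case: gC.
  rewrite (loc_ubounded_mkbfun t gb)// /g /r /F /= bfun_evalE.
  by rewrite addrA subrK opprB addrA.
have zE l t : Sigma l -> z l t = x l t - y l t.
  by move=> Sl; rewrite /z mkbfunE//; exists (2 * eps * D / rho / (1 - 2 * c * D / rho)) => s; exact: Hxy.
pose Gam (u h : bfun R X) := forall t : R, is_derive t 1 u (A t (u t) + h t).
have GL : graph_linear Gam.
  move=> a u h u' h' uh uh' t.
  have := is_deriveD (is_deriveZ a (uh t)) (uh' t).
  have -> : A t ((a *: u + u') t) + (a *: h + h') t =
      a *: (A t (u t) + h t) + (A t (u' t) + h' t).
    by rewrite !bfunDE !bfunZE linearP scalerDr addrACA.
  exact.
have GB : graph_bounded Gam (2 * D / rho).
  move=> u h uh; apply: bfun_norm_le => t.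
  exact: (dichotomy_bound HT Hdich uh (ler_bfun u) (ler_bfun h) t).
have NLip l u v : Sigma l -> `|N (l, u) - N (l, v)| <= c * `|u - v|.
  move=> Sl; apply: bfun_norm_le => t; rewrite bfunBE !NE//.
  rewrite opprB addrA subrK opprD addrA [_ + A t _ - _]addrAC addrK.
  rewrite (le_trans (HLip _ _ _ _ Sl))// ler_wpM2l//.
  by rewrite opprD addrACA subrr add0r -bfunBE ler_bfun.
(* Since y + z = x, both sides equal A x + f(x) - y' = x' - y'. *)
have zN l : Sigma l -> Gam (z l) (N (l, z l)).
  move=> Sl t.
  have zfun : (z l : R -> X) = x l - y l by apply/funext => s; rewrite zE.
  have dy : is_derive t 1 (y l) (derive1 (y l) t).
    by split; [exact: Hyd | rewrite derive1E].
  have -> : A t (z l t) + N (l, z l) t =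
      A t (x l t) + f l t (x l t) - derive1 (y l) t.
    rewrite NE// zE// subrKC blin_linearB !addrA.
    by rewrite [LHS](ACl (1*3*2*4*5))/= subrK.
  by rewrite zfun; exact: is_deriveB (Hx l Sl t) dy.
(* The product of the a priori bound and the Lipschitz constant is the quantity of [Hq]. *)
have kc : 2 * D / rho * c < 1.
  by apply: le_lt_trans Hq; rewrite le_eqVlt; apply/orP; left; apply/eqP; ring.
have kap0 : 0 <= 2 * D / rho by rewrite divr_ge0 ?(ltW rho0)// mulr_ge0// ltW.
have zC : class_C k Sigma z.
  have Bc : seq_complete (bfun R X).
    exact/bfun_seq_complete/completeNormedModType_seq_complete.
  exact: (class_C_graph_solution HSigma kap0 Hc kc Bc GL GB NLip zN NC).
move=> t.
apply: (@class_C_eq _ _ _ k Sigma (fun l => y l t + bfun_eval X t (z l)) _ HSigma).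
  by move=> l Sl; rewrite bfun_evalE zE// subrKC.
apply: (class_CD HSigma (class_CW (Hy_smooth t))).
exact: class_C_post.
Qed.
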